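(* Let $W$ be a finite reflection (Coxeter) group, $w\in W$, and fix a reduced expression $w=s_1\cdots s_k$. Let $\phi:\mathrm{NBC}(w)\to[e,w]$ be the map $\{\alpha_{i_1},\ldots,\alpha_{i_m}\}\mapsto t_{i_1}\cdots t_{i_m}w$ (where $i_1<\cdots<i_m$). Then $\phi$ is surjective, hence bijective, if and only if $\mathrm{al}(u,w)=\ell'(uw^{-1})$ for all $u\le w$.
   Context: $W$ is realised as a group generated by orthogonal reflections of $\mathbb{R}^n$ with root system $\Phi$ and positive roots $\Phi^+$, reflections corresponding bijectively to positive roots. $S$ is the set of simple reflections, $T=\{xsx^{-1}:x\in W,s\in S\}$ the set of reflections, $\ell$ the Coxeter length, $\ell'$ the absolute length (minimal number of factors from $T$). The Bruhat graph has vertex set $W$ and directed edges $x\to tx$ ($t\in T$) when $\ell(x)<\ell(tx)$; Bruhat order $\le$ is its transitive closure, $[e,w]=\{u\in W:u\le w\}$, and $\mathrm{al}(u,w)$ is the directed distance from $u$ to $w$ in the Bruhat graph. For $i\in[k]$, $t_i=s_1\cdots s_{i-1}s_is_{i-1}\cdots s_1$ and $\alpha_i\in\Phi^+$ is its root. A circuit is a minimal linearly dependent subset of $\{\alpha_1,\ldots,\alpha_k\}$; a broken circuit is a circuit with its largest-index element removed; $\mathrm{NBC}(w)$ is the family of subsets of $\{\alpha_1,\ldots,\alpha_k\}$ containing no broken circuit. It is known that $\phi$ is well defined and injective, and that $\#\mathrm{NBC}(w)$ equals the number of regions of the arrangement of hyperplanes orthogonal to $\alpha_1,\ldots,\alpha_k$.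 *)

(* Defs.v *)
From mathcomp Require Import all_boot all_order all_algebra.
From mathcomp Require Import boolp classical_sets functions reals.
From Stdlib Require Import Relation_Operators.

Set Implicit Arguments.
Unset Strict Implicit.
Unset Printing Implicit Defensive.

Import Order.TTheory GRing.Theory Num.Theory.

Local Open Scope classical_set_scope.
Local Open Scope ring_scope.

(* The least element of [P], and 0 by convention if [P] is empty. *)
Definition min_nat (P : set nat) : nat :=
  xget 0%N [set k | P k /\ forall j, P j -> (k <= j)%N].

(* Isometries of R^n are matrices acting on column vectors on the left, so that
   the matrix product is the composition of maps. *)

Definition dotc (R : realType) (n : nat) (u v : 'cV[R]_n) : R :=
  \sum_i u i 0 * v i 0.

Definition refl (R : realType) (n : nat) (a : 'cV[R]_n) : 'M[R]_n :=
  1%:M - (2 / dotc a a) *: (a *m a^T).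

Definition mxprod (R : realType) (n : nat) (r : seq 'M[R]_n) : 'M[R]_n :=
  \big[mulmx/1%:M]_(x <- r) x.

Record root_system (R : realType) (n : nat) (Phi : seq 'cV[R]_n) : Prop := {
  root_neq0 : forall a, a \in Phi -> a != 0 ;
  root_line : forall a (c : R), a \in Phi ->
    (c *: a \in Phi) = (c == 1) || (c == -1) ;
  root_stable : forall a b, a \in Phi -> b \in Phi -> refl a *m b \in Phi }.

Definition nonneg_comb (R : realType) (n : nat) (Delta : seq 'cV[R]_n)
    (a : 'cV[R]_n) : Prop :=
  exists c : 'cV[R]_n -> R,
    (forall b, b \in Delta -> 0 <= c b) /\ a = \sum_(b <- Delta) c b *: b.

Record simple_system (R : realType) (n : nat) (Phi Delta : seq 'cV[R]_n)
    : Prop := {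
  simple_root : {subset Delta <= Phi} ;
  simple_basis : basis_of <<Phi>>%VS Delta ;
  simple_sign : forall a, a \in Phi ->
    nonneg_comb Delta a \/ nonneg_comb Delta (- a) }.

Definition pos_root (R : realType) (n : nat) (Phi Delta : seq 'cV[R]_n)
    : set 'cV[R]_n :=
  [set a | a \in Phi /\ nonneg_comb Delta a].

(* Reflections are involutions, so the products of reflections already form the
   subgroup that they generate. *)
Definition refl_group (R : realType) (n : nat) (Phi : seq 'cV[R]_n)
    : set 'M[R]_n :=
  [set x | exists2 r : seq 'cV[R]_n,
     {subset r <= Phi} & x = mxprod [seq refl a | a <- r]].

Definition simple_refl (R : realType) (n : nat) (Delta : seq 'cV[R]_n)
    : set 'M[R]_n :=
  [set s | exists2 a, a \in Delta & s = refl a].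

Definition reflections (R : realType) (n : nat) (Phi Delta : seq 'cV[R]_n)
    : set 'M[R]_n :=
  [set t | exists x s, [/\ refl_group Phi x, simple_refl Delta s &
                          t = x *m s *m invmx x]].

Definition word_length (R : realType) (n : nat) (A : set 'M[R]_n)
    (x : 'M[R]_n) : nat :=
  min_nat [set k | exists r : seq 'M[R]_n,
             [/\ size r = k, (forall s, s \in r -> A s) & x = mxprod r]].

Definition cox_length (R : realType) (n : nat) (Delta : seq 'cV[R]_n)
    (x : 'M[R]_n) : nat :=
  word_length (simple_refl Delta) x.

Definition abs_length (R : realType) (n : nat) (Phi Delta : seq 'cV[R]_n)
    (x : 'M[R]_n) : nat :=
  word_length (reflections Phi Delta) x.

Definition bruhat_edge (R : realType) (n : nat) (Phi Delta : seq 'cV[R]_n)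
    (x y : 'M[R]_n) : Prop :=
  refl_group Phi x /\
  exists t, [/\ reflections Phi Delta t, y = t *m x &
               (cox_length Delta x < cox_length Delta y)%N].

Definition bruhat_le (R : realType) (n : nat) (Phi Delta : seq 'cV[R]_n)
    (x y : 'M[R]_n) : Prop :=
  clos_refl_trans _ (bruhat_edge Phi Delta) x y.

Definition lower_interval (R : realType) (n : nat) (Phi Delta : seq 'cV[R]_n)
    (w : 'M[R]_n) : set 'M[R]_n :=
  [set u | refl_group Phi u /\ bruhat_le Phi Delta u w].

Fixpoint bruhat_walk (R : realType) (n : nat) (Phi Delta : seq 'cV[R]_n)
    (k : nat) (x y : 'M[R]_n) : Prop :=
  match k with
  | 0 => x = y
  | k'.+1 => exists2 z, bruhat_edge Phi Delta x z &
                        bruhat_walk Phi Delta k' z y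
  end.

Definition bruhat_dist (R : realType) (n : nat) (Phi Delta : seq 'cV[R]_n)
    (x y : 'M[R]_n) : nat :=
  min_nat [set k | bruhat_walk Phi Delta k x y].

Definition reduced_expr (R : realType) (n : nat) (Delta : seq 'cV[R]_n)
    (w : 'M[R]_n) (k : nat) (s : k.-tuple 'M[R]_n) : Prop :=
  [/\ forall i, simple_refl Delta (tnth s i), w = mxprod s &
      cox_length Delta w = k].

(* With letters numbered from 0: s_0 ... s_(i-1) s_i s_(i-1) ... s_0. *)
Definition inv_refl (R : realType) (n k : nat) (s : k.-tuple 'M[R]_n)
    (i : 'I_k) : 'M[R]_n :=
  mxprod (take i.+1 s ++ rev (take i s)).

(* The positive root whose reflection is [t]; it is unique when [t] is a
   reflection, and the value is 0 if [t] is not one. *)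
Definition root_of (R : realType) (n : nat) (Phi Delta : seq 'cV[R]_n)
    (t : 'M[R]_n) : 'cV[R]_n :=
  xget 0 [set a | pos_root Phi Delta a /\ refl a = t].

Definition inv_root (R : realType) (n : nat) (Phi Delta : seq 'cV[R]_n)
    (k : nat) (s : k.-tuple 'M[R]_n) (i : 'I_k) : 'cV[R]_n :=
  root_of Phi Delta (inv_refl s i).

(* A subset of {alpha_i} is encoded by its set of indices; the alpha_i attached
   to a reduced expression are pairwise distinct, so nothing is lost. *)

Definition circuit (R : realType) (n k : nat) (alpha : 'I_k -> 'cV[R]_n)
    (C : {set 'I_k}) : bool :=
  minset (fun A : {set 'I_k} => ~~ free [seq alpha i | i in A]) C.

Definition broken_circuit (R : realType) (n k : nat)
    (alpha : 'I_k -> 'cV[R]_n) (B : {set 'I_k}) : Prop :=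
  exists C m, [/\ circuit alpha C, m \in C,
                  (forall j, j \in C -> (j <= m)%N) & B = C :\ m].

Definition NBC (R : realType) (n : nat) (Phi Delta : seq 'cV[R]_n)
    (k : nat) (s : k.-tuple 'M[R]_n) : set {set 'I_k} :=
  [set A | forall B, broken_circuit (inv_root Phi Delta s) B ->
                     ~~ (B \subset A)].

(* [enum A] lists the indices of [A] in increasing order. *)
Definition nbc_map (R : realType) (n k : nat) (w : 'M[R]_n)
    (s : k.-tuple 'M[R]_n) (A : {set 'I_k}) : 'M[R]_n :=
  mxprod [seq inv_refl s i | i <- enum A] *m w.

(* Main.v *)
(** Positivity of a root is the sign of its height, a linear functional, and
    [x -> t_a x] is an edge of the Bruhat graph iff [x^-1 a] is positive.

    If A is NBC, its roots are independent, so [t_A] fixes exactly the vectors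
    orthogonal to them (Carter).  Hence [t_A] has absolute length #|A| and
    determines the span of A, whose largest inversion must lie in A: this gives
    injectivity by induction.  Left multiplication by a simple reflection turns
    walks into walks, up to one edge, so deleting m letters from a reduced word
    of w gives an element at directed distance at most m from w.  Therefore
    surjectivity of phi implies al = l'.

    Conversely let al = l' below w and u = x w <= w.  A shortest walk from u to w
    has its labels in V = im (x - 1), since every x is a product of reflections
    in dim V independent roots.  Let alpha_c be the last inversion of w in V.
    The root of r = w^-1 t_c w is simple in the subsystem w^-1 V, so the lifting
    property on the right gives x t_c w = u r <= w.  As x t_c moves a smaller
    space, induction provides an NBC set B with t_B = x t_c, and toggling c in B
    gives an NBC set for x. *)

Require Import Defs.
From mathcomp Require Import all_boot all_order all_algebra.
From mathcomp Require Import boolp classical_sets functions reals.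
From mathcomp Require Import lra.
From Stdlib Require Import Relation_Operators.

Set Implicit Arguments.
Unset Strict Implicit.
Unset Printing Implicit Defensive.

Import Order.TTheory GRing.Theory Num.Theory.

Local Open Scope classical_set_scope.
Local Open Scope ring_scope.

(** A member of [P] excludes the default branch of [xget]. *)
Lemma min_nat_spec (P : set nat) (m : nat) :
  P m -> P (min_nat P) /\ forall j, P j -> (min_nat P <= j)%N.
Proof.
move=> Pm; rewrite /min_nat; case: xgetP => [j -> //|noP].
have exP : exists j, `[< P j >] by exists m; apply/asboolP.
case: (ex_minnP exP) => j /asboolP Pj minj.
by case: (noP j); split => // i Pi; apply: minj; apply/asboolP.
Qed.

(** * Reflections of R^n, their products, and spans of their roots *)

Section Reflections.
Variables (R : realType) (n : nat).
Implicit Types (a u v z : 'cV[R]_n) (x y : 'M[R]_n) (X L : seq 'cV[R]_n).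

Lemma dotc_mx u v : u^T *m v = (dotc u v)%:M.
Proof.
apply/matrixP => i j; rewrite !ord1 !mxE eqxx mulr1n.
by apply: eq_bigr => l _; rewrite !mxE.
Qed.

Lemma dotcC u v : dotc u v = dotc v u.
Proof. by apply: eq_bigr => i _; rewrite mulrC. Qed.

Lemma dotcDr u v z : dotc u (v + z) = dotc u v + dotc u z.
Proof. by rewrite -big_split; apply: eq_bigr => i _; rewrite mxE mulrDr. Qed.

Lemma dotcZr c u v : dotc u (c *: v) = c * dotc u v.
Proof. by rewrite mulr_sumr; apply: eq_bigr => i _; rewrite mxE mulrCA. Qed.

Lemma dotcNr u v : dotc u (- v) = - dotc u v.
Proof. by rewrite -scaleN1r dotcZr mulN1r. Qed.

Lemma dotc0r u : dotc u 0 = 0.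
Proof. by rewrite -(scale0r 0) dotcZr mul0r. Qed.

Lemma dotcDl u v z : dotc (v + z) u = dotc v u + dotc z u.
Proof. by rewrite dotcC dotcDr !(dotcC u). Qed.

Lemma dotcZl c u v : dotc (c *: v) u = c * dotc v u.
Proof. by rewrite dotcC dotcZr (dotcC u). Qed.

Lemma dotcNl u v : dotc (- v) u = - dotc v u.
Proof. by rewrite dotcC dotcNr (dotcC u). Qed.

Lemma dotc0l u : dotc 0 u = 0.
Proof. by rewrite dotcC dotc0r. Qed.

Lemma dotc_suml (I : Type) (r : seq I) (F : I -> 'cV[R]_n) u :
  dotc (\sum_(i <- r) F i) u = \sum_(i <- r) dotc (F i) u.
Proof.
elim: r => [|i r IH]; first by rewrite !big_nil dotc0l.
by rewrite !big_cons dotcDl IH.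
Qed.

Lemma dotc_ge0 u : 0 <= dotc u u.
Proof. by apply: sumr_ge0 => i _; rewrite -expr2 sqr_ge0. Qed.

Lemma dotc_eq0 u : (dotc u u == 0) = (u == 0).
Proof.
apply/idP/eqP => [|->]; last by rewrite dotc0l.
rewrite psumr_eq0 => [/allP u0|i _]; last by rewrite -expr2 sqr_ge0.
apply/colP => i; rewrite mxE; apply/eqP.
by have := u0 i (mem_index_enum _); rewrite /= -expr2 sqrf_eq0.
Qed.

Lemma dotc_gt0 u : u != 0 -> 0 < dotc u u.
Proof. by rewrite lt0r dotc_eq0 dotc_ge0 andbT. Qed.

Lemma dotc_adj x u v : dotc (x *m u) v = dotc u (x^T *m v).
Proof.
have /matrixP/(_ 0 0) : (x *m u)^T *m v = u^T *m (x^T *m v).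
  by rewrite trmx_mul mulmxA.
by rewrite !dotc_mx !mxE !mulr1n.
Qed.

Lemma refl_mul a v : refl a *m v = v - (2 * dotc a v / dotc a a) *: a.
Proof.
rewrite mulmxBl mul1mx -scalemxAl -mulmxA dotc_mx mul_mx_scalar scalerA.
by rewrite mulrAC.
Qed.

Lemma refl_tr a : (refl a)^T = refl a.
Proof. by rewrite linearB linearZ /= trmx1 trmx_mul trmxK. Qed.

Lemma refl_perp a v : dotc a v = 0 -> refl a *m v = v.
Proof. by move=> av0; rewrite refl_mul av0 mulr0 mul0r scale0r subr0. Qed.

Lemma refl_self a : refl a *m a = - a.
Proof.
have [->|a0] := eqVneq a 0; first by rewrite mulmx0 oppr0.
rewrite refl_mul mulfK ?dotc_eq0 // -{1}[a]scale1r -scalerBl.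
by rewrite -[RHS]scaleN1r; congr (_ *: _); lra.
Qed.

Lemma refl_sqr a : refl a *m refl a = 1%:M.
Proof.
rewrite {2}/refl mulmxBr mulmx1 -scalemxAr mulmxA refl_self mulNmx scalerN opprK.
by rewrite /refl subrK.
Qed.

Lemma reflK a (m : nat) (M : 'M[R]_(n, m)) : refl a *m (refl a *m M) = M.
Proof. by rewrite mulmxA refl_sqr mul1mx. Qed.

Lemma reflN a : refl (- a) = refl a.
Proof. by rewrite /refl dotcNl dotcNr opprK linearN /= mulNmx mulmxN opprK. Qed.

Lemma dotc_orth x u v : x^T *m x = 1%:M -> dotc (x *m u) (x *m v) = dotc u v.
Proof. by move=> xx; rewrite dotc_adj mulmxA xx mul1mx. Qed.

Lemma refl_conj x a : x^T *m x = 1%:M -> refl (x *m a) = x *m refl a *m x^T.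
Proof.
move=> xx; have xx' := mulmx1C xx.
rewrite /refl dotc_orth // mulmxBr mulmxBl mulmx1 xx'.
by rewrite trmx_mul -scalemxAr -scalemxAl !mulmxA.
Qed.

Lemma mxprod_nil : mxprod [::] = 1%:M :> 'M[R]_n.
Proof. by rewrite /mxprod big_nil. Qed.

Lemma mxprod_cons x (r : seq 'M[R]_n) : mxprod (x :: r) = x *m mxprod r.
Proof. by rewrite /mxprod big_cons. Qed.

Lemma mxprod_cat (r1 r2 : seq 'M[R]_n) : mxprod (r1 ++ r2) = mxprod r1 *m mxprod r2.
Proof.
elim: r1 => [|x r1 IH]; first by rewrite mxprod_nil mul1mx.
by rewrite cat_cons !mxprod_cons IH mulmxA.
Qed.

Definition rprod X : 'M[R]_n := mxprod [seq refl a | a <- X].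

Lemma rprod_nil : rprod [::] = 1%:M.
Proof. exact: mxprod_nil. Qed.

Lemma rprod_cons a X : rprod (a :: X) = refl a *m rprod X.
Proof. exact: mxprod_cons. Qed.

Lemma rprod_cat X L : rprod (X ++ L) = rprod X *m rprod L.
Proof. by rewrite /rprod map_cat mxprod_cat. Qed.

Lemma rprod1 a : rprod [:: a] = refl a.
Proof. by rewrite rprod_cons rprod_nil mulmx1. Qed.

Lemma rprod_rev X : rprod (rev X) = (rprod X)^T.
Proof.
elim: X => [|a X IH]; first by rewrite rprod_nil trmx1.
by rewrite rev_cons -cats1 rprod_cat rprod1 rprod_cons trmx_mul IH refl_tr.
Qed.

Lemma rprod_orth X : (rprod X)^T *m rprod X = 1%:M.
Proof.
elim: X => [|a X IH]; first by rewrite rprod_nil trmx1 mulmx1.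
by rewrite rprod_cons trmx_mul refl_tr -mulmxA reflK.
Qed.

Lemma span_perp X v z :
  v \in <<X>>%VS -> (forall a, a \in X -> dotc a z = 0) -> dotc v z = 0.
Proof.
move=> vX Xz; rewrite (@coord_span _ _ _ (in_tuple X) v vX) dotc_suml big1 //.
by move=> i _; rewrite dotcZl Xz ?mulr0 // mem_nth.
Qed.

(** A span is its own double orthogonal complement: the columns of the cokernel of the matrix with
    rows [X] are orthogonal to [X], so they test membership. *)
Lemma perp_span X v :
  (forall z, (forall a, a \in X -> dotc a z = 0) -> dotc v z = 0) ->
  v \in <<X>>%VS.
Proof.
pose M : 'M[R]_(size X, n) := \matrix_(i < size X) (X`_i)^T.
move=> Xv; have /submxP [D vD] : (v^T <= M)%MS.
  rewrite submxE; apply/eqP/rowP => j.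
  set z := col j (cokermx M).
  have Xz : forall a, a \in X -> dotc a z = 0.
    move=> a /(nthP 0) [i iX <-].
    have /matrixP/(_ (Ordinal iX) j) := mulmx_coker M.
    rewrite !mxE => Mij; rewrite -[RHS]Mij; apply: eq_bigr => l _.
    by rewrite !mxE.
  have := Xv z Xz; rewrite !mxE => vz; rewrite -[RHS]vz.
  by apply: eq_bigr => l _; rewrite !mxE.
have -> : v = \sum_(i < size X) D 0 i *: X`_i.
  apply/colP => l; have /matrixP/(_ 0 l) := vD.
  rewrite !mxE summxE => ->; apply: eq_bigr => i _; by rewrite !mxE.
by apply: memv_suml => i _; rewrite memvZ // memv_span // mem_nth.
Qed.

Lemma rprod_subr_span X z : rprod X *m z - z \in <<X>>%VS.
Proof.
elim: X => [|a X IH]; first by rewrite rprod_nil mul1mx subrr mem0v.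
rewrite rprod_cons -mulmxA refl_mul addrAC memvB //.
  by apply: subvP IH; rewrite span_cons addvSr.
by rewrite memvZ // memv_span // mem_head.
Qed.

Lemma rprod_fix X z : (forall a, a \in X -> dotc a z = 0) -> rprod X *m z = z.
Proof.
elim: X => [|a X IH] Xz; first by rewrite rprod_nil mul1mx.
rewrite rprod_cons -mulmxA IH => [|b bX]; last by rewrite Xz // inE bX orbT.
by rewrite refl_perp // Xz ?mem_head.
Qed.

(** Half of Carter's lemma. If [z] is fixed, the first reflection and the product of the others move
    [z] by the same vector; it is a multiple of [a] in the span of the other roots, so independence
    makes it vanish. *)
Lemma free_rprod_fix X z :
  free X -> rprod X *m z = z -> forall a, a \in X -> dotc a z = 0.
Proof.
elim: X => [|a X IH] //; rewrite free_cons => /andP [aX fX].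
rewrite rprod_cons -mulmxA => /(congr1 (mulmx (refl a))); rewrite reflK => Xz.
have a0 : a != 0 by apply: contraNneq aX => ->; rewrite mem0v.
have az : dotc a z = 0.
  have := rprod_subr_span X z; rewrite Xz refl_mul addrC addKr.
  rewrite -scaleNr => kaX; apply/eqP; apply: contraNT aX => az.
  set k := - _ in kaX; have k0 : k != 0.
    by rewrite oppr_eq0 !mulf_neq0 ?invr_eq0 ?dotc_eq0 ?pnatr_eq0.
  by rewrite -[a](scalerK k0) memvZ.
move=> b; rewrite inE => /predU1P [-> //|bX].
by apply: IH bX => //; rewrite Xz refl_perp.
Qed.

(** Vectors orthogonal to [L] are fixed by the product, hence orthogonal to the independent family
    [X]; passing to complements reverses the inclusion. *)
Lemma free_rprod_span X L : free X -> rprod X = rprod L -> (<<X>> <= <<L>>)%VS.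
Proof.
move=> fX XL; apply/span_subvP => a aX; apply: perp_span => z Lz.
by apply: (free_rprod_fix fX) aX; rewrite XL rprod_fix.
Qed.

Lemma free_rprod_size X L : free X -> rprod X = rprod L -> (size X <= size L)%N.
Proof.
move=> fX /(free_rprod_span fX)/dimvS.
by rewrite (eqnP fX) => /leq_trans; apply; exact: dim_span.
Qed.

End Reflections.

(** Gives the strict decrease in the two inductions that count roots: conjugation to a simple root,
    and reflection to a dominant vector. *)
Lemma count_ltn (T : eqType) (p q : pred T) (l : seq T) b :
  {in l, subpred p q} -> b \in l -> q b -> ~~ p b -> (count p l < count q l)%N.
Proof.
elim: l => [//|c l IH] /= pq; rewrite inE => bl qb pb.
have pql : {in l, subpred p q} by move=> e el; apply: pq; rewrite inE el orbT.
have le : (count p l <= count q l)%N.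
  elim: l {IH bl pq} pql => //= e l IH pql; apply: leq_add; last first.
    by apply: IH => f fl; apply: pql; rewrite inE fl orbT.
  by have := pql e (mem_head _ _); case: (p e) => // ->.
have := pq c (mem_head _ _).
case/predU1P: bl => [<- _|bl pqc]; first by rewrite (negPf pb) qb.
have := IH pql bl qb pb; case: (p c) pqc => [->|_] //.
by rewrite add0n => /leq_trans-> //; rewrite leq_addl.
Qed.

(** * The height functional and labelled Bruhat walks *)

Section HeightDef.
Variables (R : realType) (n : nat) (Delta : seq 'cV[R]_n).
Implicit Types (a b v : 'cV[R]_n).

(** [coord] is a total linear function, so the height is linear on all of R^n and not only on the
    span of [Delta]. *)
Definition height v : R := \sum_(i < size Delta) coord (in_tuple Delta) i v.

Lemma heightD u v : height (u + v) = height u + height v.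
Proof. by rewrite -big_split; apply: eq_bigr => i _; rewrite linearD. Qed.

Lemma heightZ c v : height (c *: v) = c * height v.
Proof. by rewrite mulr_sumr; apply: eq_bigr => i _; rewrite linearZ. Qed.

Lemma heightN v : height (- v) = - height v.
Proof. by rewrite -scaleN1r heightZ mulN1r. Qed.

Lemma heightB u v : height (u - v) = height u - height v.
Proof. by rewrite heightD heightN. Qed.

Lemma coord_comb (c : 'cV[R]_n -> R) (i : 'I_(size Delta)) : free Delta ->
  coord (in_tuple Delta) i (\sum_(b <- Delta) c b *: b) = c Delta`_i.
Proof.
move=> fD; rewrite (big_nth 0) big_mkord.
exact: (@coord_sum_free _ _ _ (in_tuple Delta) (fun j => c Delta`_j) i fD).
Qed.

Lemma height_comb (c : 'cV[R]_n -> R) : free Delta ->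
  height (\sum_(b <- Delta) c b *: b) = \sum_(b <- Delta) c b.
Proof.
move=> fD; rewrite [RHS](big_nth 0) big_mkord.
by apply: eq_bigr => i _; rewrite coord_comb.
Qed.

Lemma height_simple d : free Delta -> d \in Delta -> height d = 1.
Proof.
move=> fD dD; have dE : d = \sum_(b <- Delta) (b == d)%:R *: b.
  rewrite (bigD1_seq d) ?free_uniq //= eqxx scale1r big1 ?addr0 // => b bd.
  by rewrite (negPf bd) scale0r.
rewrite {1}dE (height_comb (fun b => (b == d)%:R)) //.
rewrite (bigD1_seq d) ?free_uniq //= eqxx big1 ?addr0 // => b bd.
by rewrite (negPf bd).
Qed.

(** For [x] in the group, [x^T] is the inverse of [x]; the increase of length along the edge from
    [x] to [refl a *m x] is thus encoded as the sign of one root. *)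
Definition pos_label (Phi : seq 'cV[R]_n) (x : 'M[R]_n) a :=
  [&& a \in Phi, 0 < height a & 0 < height (x^T *m a)].

(* Upward walks in the Bruhat graph with the list of the positive roots of the
   reflections that label their edges. *)
Fixpoint lwalk (Phi : seq 'cV[R]_n) (L : seq 'cV[R]_n) (x y : 'M[R]_n) : Prop :=
  if L is a :: L' then pos_label Phi x a /\ lwalk Phi L' (refl a *m x) y
  else x = y.

End HeightDef.

(** * Positive roots, lengths and Bruhat edges *)

Section RootSystem.
Variables (R : realType) (n : nat) (Phi Delta : seq 'cV[R]_n).
Hypothesis hPhi : root_system Phi.
Hypothesis hDelta : simple_system Phi Delta.
Implicit Types (a b d v z : 'cV[R]_n) (x y : 'M[R]_n) (L r : seq 'cV[R]_n).

Local Notation W := (refl_group Phi).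
Local Notation h := (height Delta).
Local Notation edge_root := (pos_label Delta Phi).
Local Notation walk := (lwalk Delta Phi).

Lemma simple_free : free Delta.
Proof. exact: basis_free (simple_basis hDelta). Qed.

Lemma simple_rootE d : d \in Delta -> d \in Phi.
Proof. exact: (simple_root hDelta). Qed.

Lemma rootN a : a \in Phi -> - a \in Phi.
Proof. by move=> aP; rewrite -scaleN1r (root_line hPhi) // eqxx orbT. Qed.

Lemma simple_height d : d \in Delta -> h d = 1.
Proof. by apply: height_simple; exact: simple_free. Qed.

Lemma comb_height_gt0 a : a != 0 -> nonneg_comb Delta a -> 0 < h a.
Proof.
move=> + [c [c0 aE]]; rewrite aE (height_comb c simple_free) => a0.
have s0 : 0 <= \sum_(b <- Delta) c b.
  by rewrite big_seq sumr_ge0 // => b /c0.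
rewrite lt0r s0 andbT; apply: contraNneq a0 => sum0.
rewrite big_seq big1 // => b bD.
suff -> : c b = 0 by rewrite scale0r.
apply/eqP; rewrite eq_le c0 // andbT -sum0 (big_rem b) //= lerDl.
by rewrite big_seq sumr_ge0 // => e /mem_rem/c0.
Qed.

Lemma root_height_neq0 a : a \in Phi -> h a != 0.
Proof.
move=> aP; have a0 := root_neq0 hPhi aP.
case: (simple_sign hDelta aP) => /comb_height_gt0.
  by move=> /(_ a0)/lt0r_neq0.
by rewrite oppr_eq0 => /(_ a0)/lt0r_neq0; rewrite heightN oppr_eq0.
Qed.

Lemma root_height_lt0 a : a \in Phi -> (h a < 0) = ~~ (0 < h a).
Proof. by move=> /root_height_neq0 a0; rewrite -leNgt lt_neqAle a0. Qed.

Lemma pos_rootP a : pos_root Phi Delta a <-> a \in Phi /\ 0 < h a.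
Proof.
split=> -[aP apos]; split=> //.
  exact: comb_height_gt0 (root_neq0 hPhi aP) apos.
case: (simple_sign hDelta aP) => // /comb_height_gt0.
rewrite oppr_eq0 heightN => /(_ (root_neq0 hPhi aP)); lra.
Qed.

(** The reflection in [d] changes only the coordinate at [d]. If the image of [a] were negative, all
    other coordinates of [a] would vanish, so [a] would be a positive multiple of [d], that is
    [d]. *)
Lemma simple_permutes_pos d a : d \in Delta -> a \in Phi -> 0 < h a ->
  a != d -> 0 < h (refl d *m a).
Proof.
move=> dD aP apos; apply: contra_neqT; have dP := simple_rootE dD.
have sP : refl d *m a \in Phi by exact: root_stable hPhi _ _ dP aP.
move=> sneg; have [_ [c [c0 aE]]] := (pos_rootP a).2 (conj aP apos).
have [_ [c' [c'0 sE]]] : pos_root Phi Delta (- (refl d *m a)).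
  by apply/pos_rootP; rewrite rootN // heightN oppr_gt0 root_height_lt0.
have cd : forall b, b \in Delta -> b != d -> c b = 0.
  move=> b bD bd; set i := index b Delta.
  have iD : (i < size Delta)%N by rewrite index_mem.
  have ci (f : 'cV[R]_n -> R) :
      coord (in_tuple Delta) (Ordinal iD) (\sum_(e <- Delta) f e *: e) = f b.
    by rewrite coord_comb ?simple_free //= nth_index.
  have d0 : coord (in_tuple Delta) (Ordinal iD) d = 0.
    have dE : d = \sum_(e <- Delta) (e == d)%:R *: e.
      rewrite (bigD1_seq d) ?free_uniq ?simple_free //= eqxx scale1r big1 ?addr0 //.
      by move=> e ed; rewrite (negPf ed) scale0r.
    by rewrite dE (ci (fun e => (e == d)%:R)) (negPf bd).
  have := congr1 (coord (in_tuple Delta) (Ordinal iD)) sE.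
  rewrite refl_mul opprB linearB linearZ /= d0 mulr0 sub0r ci.
  rewrite {1}aE ci => cE; have := c0 b bD; have := c'0 b bD; lra.
have ad : a = c d *: d.
  rewrite {1}aE (bigD1_seq d) ?free_uniq ?simple_free //= big_seq_cond big1 ?addr0 //.
  by move=> b /andP[bD bd]; rewrite cd // scale0r.
move: aP; rewrite ad (root_line hPhi) // => /orP [] /eqP cE.
  by rewrite cE scale1r.
by move: apos; rewrite ad heightZ simple_height // cE mulr1 oppr_gt0 ltr10.
Qed.

Lemma W_orth x : W x -> x^T *m x = 1%:M.
Proof. by move=> [r _ ->]; exact: rprod_orth. Qed.

Lemma W_orthr x : W x -> x *m x^T = 1%:M.
Proof. by move/W_orth/mulmx1C. Qed.

Lemma invmx_W x : W x -> invmx x = x^T.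
Proof.
move=> /W_orthr xx; have [ux _] := mulmx1_unit xx.
by rewrite -[RHS]mul1mx -(mulVmx ux) -mulmxA xx mulmx1.
Qed.

Lemma W_refl a : a \in Phi -> W (refl a).
Proof.
move=> aP; exists [:: a]; rewrite ?mxprod_cons ?mxprod_nil ?mulmx1 //.
by move=> b /[!inE] /eqP->.
Qed.

Lemma W_mul x y : W x -> W y -> W (x *m y).
Proof.
move=> [r rP ->] [r' r'P ->]; exists (r ++ r'); last by rewrite map_cat mxprod_cat.
by move=> a; rewrite mem_cat => /orP [/rP|/r'P].
Qed.

Lemma W_tr x : W x -> W x^T.
Proof.
move=> [r rP ->]; exists (rev r); last by rewrite -[LHS]rprod_rev.
by move=> a; rewrite mem_rev => /rP.
Qed.

Lemma W_rprod r : {subset r <= Phi} -> W (rprod r).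
Proof. by exists r. Qed.

Lemma W_root x a : W x -> a \in Phi -> x *m a \in Phi.
Proof.
move=> [r + ->] aP; elim: r => [|b r IH] rP.
  by rewrite mxprod_nil mul1mx.
rewrite /= mxprod_cons -mulmxA; apply: (root_stable hPhi).
  exact: rP (mem_head _ _).
by apply: IH => c cr; rewrite rP // inE cr orbT.
Qed.

(** Induction on the number of roots of smaller height. Some simple root has positive inner product
    with [a], since otherwise [dotc a a] would be nonpositive; reflecting in it lowers the height
    and, unless [a] is simple, keeps the root positive. *)
Lemma root_conj_simple a : a \in Phi -> 0 < h a ->
  exists r d, [/\ {subset r <= Delta}, d \in Delta & a = rprod r *m d].
Proof.
have [m] := ubnP (count (fun b => h b < h a) Phi).
elim: m a => // m IH a /ltnSE cm aP apos.
have [aD|aD] := boolP (a \in Delta).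
  by exists [::], a; split=> //; rewrite rprod_nil mul1mx.
have [_ [c [c0 aE]]] := (pos_rootP a).2 (conj aP apos).
have [d dD da] : exists2 d, d \in Delta & 0 < dotc d a.
  apply: contrapT => nod.
  have := dotc_gt0 (root_neq0 hPhi aP); rewrite {1}aE dotc_suml ltNge => /negP; apply.
  rewrite big_seq sumr_le0 // => b bD; rewrite dotcZl mulr_ge0_le0 ?c0 //.
  by rewrite leNgt; apply/negP => bpos; apply: nod; exists b.
have dP := simple_rootE dD; have a'P := root_stable hPhi dP aP.
have a'pos : 0 < h (refl d *m a).
  by apply: simple_permutes_pos => //; apply: contraNneq aD => ->.
have a'lt : h (refl d *m a) < h a.
  rewrite refl_mul heightB heightZ (simple_height dD) mulr1 ltrBlDr ltrDl.
  by rewrite divr_gt0 ?mulr_gt0 ?dotc_gt0 ?(root_neq0 hPhi).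
have [|r [e [rD eD a'E]]] := IH (refl d *m a) _ a'P a'pos.
  apply: leq_trans cm; apply: (count_ltn (b := refl d *m a)) => //=.
    by move=> b _ /= /lt_trans; apply.
  by rewrite ltxx.
exists (d :: r), e; split=> //.
  by move=> b; rewrite inE => /predU1P [-> //|/rD].
by rewrite rprod_cons -mulmxA -a'E reflK.
Qed.

Lemma W_word x : W x -> exists2 r, {subset r <= Delta} & x = rprod r.
Proof.
have posw a : a \in Phi -> 0 < h a ->
    exists2 r, {subset r <= Delta} & refl a = rprod r.
  move=> aP apos; have [r [d [rD dD ->]]] := root_conj_simple aP apos.
  (* The reflection in [rprod r *m d] is a conjugate of [refl d], spelled by a palindrome. *)
  exists (r ++ d :: rev r).
    by move=> b; rewrite mem_cat inE mem_rev => /or3P [/rD|/eqP->|/rD].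
  by rewrite refl_conj ?rprod_orth // rprod_cat rprod_cons rprod_rev mulmxA.
have rootw a : a \in Phi -> exists2 r, {subset r <= Delta} & refl a = rprod r.
  move=> aP; have [|aneg] := boolP (0 < h a); first exact: posw.
  by rewrite -reflN; apply: posw; rewrite ?rootN // heightN oppr_gt0 root_height_lt0.
move=> [r + ->]; elim: r => [|a r IH] rP.
  by exists [::]; rewrite ?rprod_nil ?mxprod_nil.
have [|r1 r1D aE] := rootw a; first by rewrite rP ?mem_head.
have [|r2 r2D rE] := IH; first by move=> b br; rewrite rP // inE br orbT.
exists (r1 ++ r2); last by rewrite rprod_cat -aE -rE mxprod_cons.
by move=> b; rewrite mem_cat => /orP [/r1D|/r2D].
Qed.

Lemma reflectionsP t :
  reflections Phi Delta t <-> exists2 a, a \in Phi /\ 0 < h a & t = refl a.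
Proof.
split=> [[x [_ [Wx [d dD ->] ->]]]|[a [aP apos] ->]].
  have xdP := W_root Wx (simple_rootE dD).
  rewrite invmx_W // -refl_conj ?W_orth //.
  have [xdpos|xdneg] := boolP (0 < h (x *m d)); first by exists (x *m d).
  exists (- (x *m d)); last by rewrite reflN.
  by rewrite rootN // heightN oppr_gt0 root_height_lt0.
have [r [d [rD dD ->]]] := root_conj_simple aP apos.
have Wr : W (rprod r) by apply: W_rprod => b /rD/simple_rootE.
exists (rprod r), (refl d); split=> //; first by exists d.
by rewrite invmx_W // refl_conj ?rprod_orth.
Qed.

Lemma map_refl_ex (P : 'cV[R]_n -> Prop) (q : seq 'M[R]_n) :
  (forall t, t \in q -> exists2 a, P a & t = refl a) ->
  exists2 L, (forall a, a \in L -> P a) & q = [seq refl a | a <- L].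
Proof.
elim: q => [|t q IH] qP; first by exists [::].
have [a Pa ->] := qP t (mem_head _ _).
have [|L LP ->] := IH; first by move=> t' t'q; apply: qP; rewrite inE t'q orbT.
by exists (a :: L) => // b; rewrite inE => /predU1P [-> //|/LP].
Qed.

Lemma cox_lengthP x : W x ->
  (exists r, [/\ {subset r <= Delta}, x = rprod r & size r = cox_length Delta x]) /\
  forall r, {subset r <= Delta} -> x = rprod r -> (cox_length Delta x <= size r)%N.
Proof.
move=> Wx; set P := [set k | exists q : seq 'M[R]_n, [/\ size q = k,
  (forall s, s \in q -> simple_refl Delta s) & x = mxprod q]].
have wordP r : {subset r <= Delta} -> x = rprod r -> P (size r).
  move=> rD xE; exists [seq refl a | a <- r]; rewrite size_map; split=> //.
  by move=> s /mapP [a /rD aD ->]; exists a.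
have [r0 r0D xE0] := W_word Wx.
have [[q [qs qD xE]] minP] := min_nat_spec (wordP _ r0D xE0).
split; last by move=> r rD /(wordP r rD)/minP.
have [L LD qE] := map_refl_ex qD.
exists L; split=> //; first by rewrite /rprod -qE.
by transitivity (size q) => //; rewrite qE size_map.
Qed.

Lemma abs_length_rprod L m : {subset L <= Phi} -> size L = m ->
  (forall L', {subset L' <= Phi} -> rprod L' = rprod L -> (m <= size L')%N) ->
  abs_length Phi Delta (rprod L) = m.
Proof.
move=> LP Lm minL.
have mP : [set k | exists q : seq 'M[R]_n, [/\ size q = k,
    (forall s, s \in q -> reflections Phi Delta s) & rprod L = mxprod q]] m.
  exists [seq refl a | a <- L]; rewrite size_map; split=> // t /mapP [a /LP aP ->].
  apply/reflectionsP; have [apos|aneg] := boolP (0 < h a); first by exists a.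
  exists (- a); last by rewrite reflN.
  by rewrite rootN // heightN oppr_gt0 root_height_lt0.
have [[q [qs qT qE]] minP] := min_nat_spec mP.
apply/eqP; rewrite eqn_leq minP //=.
have [|L' L'P qL'] := @map_refl_ex (fun a => a \in Phi /\ 0 < h a) q.
  by move=> t /qT/reflectionsP.
rewrite /abs_length /word_length -qs qL' size_map; apply: minL.
  by move=> a /L'P [].
by rewrite qE qL'.
Qed.

(** The exchange condition. The root [a] is pushed through the letters of [r]; it can turn negative
    only at a letter equal to the current root, and that letter is deleted. *)
Lemma exchange r a : {subset r <= Delta} -> a \in Phi -> 0 < h a ->
  h ((rprod r)^T *m a) < 0 ->
  exists r', [/\ {subset r' <= Delta}, (size r').+1 = size r &
                 refl a *m rprod r = rprod r'].
Proof.
elim: r a => [|d r IH] a rD aP apos; first by rewrite rprod_nil trmx1 mul1mx; lra.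
have dD : d \in Delta by rewrite rD ?mem_head.
have rD' : {subset r <= Delta} by move=> b br; rewrite rD // inE br orbT.
rewrite !rprod_cons trmx_mul refl_tr -mulmxA => aneg.
have [->|ad] := eqVneq a d; first by exists r; rewrite reflK.
have daP := root_stable hPhi (simple_rootE dD) aP.
have [|r' [r'D r's r'E]] := IH _ rD' daP _ aneg; first exact: simple_permutes_pos.
exists (d :: r'); split=> [b||].
- by rewrite inE => /predU1P [-> //|/r'D].
- by rewrite /= r's.
have refl_dd : (refl d)^T *m refl d = 1%:M.
  by rewrite -rprod1 rprod_orth.
by rewrite rprod_cons -r'E (refl_conj a refl_dd) refl_tr -!mulmxA reflK.
Qed.

(** If [x^-1 a] is negative, exchange shortens a word for [x]. The positive case is the negative one
    for [refl a *m x], whose inverse sends [a] to the opposite root. *)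
Lemma cox_length_refl x a : W x -> a \in Phi -> 0 < h a ->
  (cox_length Delta x < cox_length Delta (refl a *m x))%N = (0 < h (x^T *m a)).
Proof.
have down y : W y -> a \in Phi -> 0 < h a -> h (y^T *m a) < 0 ->
    (cox_length Delta (refl a *m y) < cox_length Delta y)%N.
  move=> Wy aP apos; have [[r [rD yE <-]] _] := cox_lengthP Wy.
  rewrite yE => /(exchange rD aP apos) [r' [r'D <- ayE]].
  rewrite ltnS -yE; apply: (cox_lengthP (W_mul (W_refl aP) Wy)).2 => //.
  by rewrite {1}yE.
move=> Wx aP apos; have xaP := W_root (W_tr Wx) aP.
have [xapos|/negP xaneg] := boolP (0 < h _).
  have := down _ (W_mul (W_refl aP) Wx) aP apos; rewrite reflK; apply.
  by rewrite trmx_mul refl_tr -mulmxA refl_self mulmxN heightN oppr_lt0.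
by apply/negbTE; rewrite -leqNgt ltnW // down // root_height_lt0 //; apply/negP.
Qed.

Lemma bruhat_edgeP x y : W x ->
  bruhat_edge Phi Delta x y <-> exists2 a, edge_root x a & y = refl a *m x.
Proof.
move=> Wx; split=> [[_ [t [/reflectionsP [a [aP apos] ->] ->]]]|[a]].
  by rewrite cox_length_refl // => xapos; exists a => //; apply/and3P.
move=> /and3P [aP apos xapos ->]; split=> //; exists (refl a); split=> //.
  by apply/reflectionsP; exists a.
by rewrite cox_length_refl.
Qed.

Lemma bruhat_walkP m x y : W x ->
  bruhat_walk Phi Delta m x y <-> exists2 L, size L = m & walk L x y.
Proof.
elim: m x => [|m IH] x Wx /=.
  by split=> [->|[[|//] _]]; [exists [::]|].
split=> [[z /(bruhat_edgeP _ Wx) [a xa ->]]|].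
  have aP : a \in Phi by case/and3P: xa.
  move=> /(IH _ (W_mul (W_refl aP) Wx)) [L Lm Lw].
  by exists (a :: L) => //=; rewrite Lm.
move=> [[//|a L] [Lm] [xa Lw]]; have aP : a \in Phi by case/and3P: xa.
exists (refl a *m x); first by apply/bruhat_edgeP => //; exists a.
by apply/IH; [exact: W_mul (W_refl aP) Wx|exists L].
Qed.

Lemma walk_cat L L' x y y' : walk L x y -> walk L' y y' -> walk (L ++ L') x y'.
Proof. by elim: L x => [|a L IH] x /= => [->|[xa /IH Lw /Lw]]. Qed.

Lemma walk_roots L x y : walk L x y -> {subset L <= Phi}.
Proof.
elim: L x => [//|a L IH] x [xa /IH LP] b; rewrite inE => /predU1P [->|/LP //].
by case/and3P: xa.
Qed.

Lemma walk_rprod L x y : walk L x y -> x = rprod L *m y.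
Proof.
elim: L x => [|a L IH] x /=; first by rewrite rprod_nil mul1mx.
by move=> [_ /IH xE]; rewrite rprod_cons -mulmxA -xE reflK.
Qed.

Lemma bruhat_leP x y : W x ->
  bruhat_le Phi Delta x y <-> exists L, walk L x y.
Proof.
move=> Wx; split=> [xy|[L]].
  (* Membership in the group is put inside the induction: in the transitive case the middle element
     inherits it through the first walk. *)
  suff : W x -> exists L, walk L x y by apply.
  elim: {x y} xy {Wx} => [x y xy Wx|x _|x y z xy IH1 yz IH2 Wx].
  - by have [a xa yE] := (bruhat_edgeP _ Wx).1 xy; exists [:: a].
  - by exists [::].
  have [L1 w1] := IH1 Wx; have [|L2 w2] := IH2.
    have := walk_rprod w1 => /(congr1 (mulmx (rprod L1)^T)).
    rewrite mulmxA rprod_orth mul1mx => <-.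
    by apply: W_mul => //; apply/W_tr/W_rprod; apply: walk_roots w1.
  by exists (L1 ++ L2); apply: walk_cat w1 w2.
elim: L x Wx => [|a L IH] x Wx /=; first by move=> ->; exact: rt_refl.
move=> [xa Lw]; have aP : a \in Phi by case/and3P: xa.
apply: (rt_trans _ _ _ (refl a *m x)).
  by apply: rt_step; apply/bruhat_edgeP => //; exists a.
by apply: IH Lw; apply: W_mul => //; exact: W_refl.
Qed.

(** The reflection in [b] negates [a], so [a] is proportional to [b]; by [root_line] they agree up
    to sign. *)
Lemma refl_pos_inj a b : a \in Phi -> b \in Phi -> 0 < h a -> 0 < h b ->
  refl a = refl b -> a = b.
Proof.
move=> aP bP apos bpos ab; have := refl_self a; rewrite ab refl_mul.
set c := _ / _ => /(canRL (addrK _)) aE.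
have {}aE : a = (c / 2) *: b.
  have : 2 *: a = c *: b.
    by rewrite scaler_nat mulr2n {1}aE opprK addrC addrA subrr add0r.
  move=> /(congr1 (fun z => 2^-1 *: z)).
  by rewrite !scalerA mulVf ?pnatr_eq0 // scale1r mulrC.
move: (aP); rewrite aE (root_line hPhi) // => /orP [] /eqP cE.
  by rewrite cE scale1r.
by move: apos; rewrite aE heightZ cE mulN1r oppr_gt0 ltNge ltW.
Qed.

Lemma walk_last L a x y : walk (rcons L a) x y ->
  [/\ a \in Phi, 0 < h a & h (y^T *m a) < 0].
Proof.
elim: L x => [|b L IH] x /= [xb]; last exact: IH.
move=> <-; case/and3P: xb => aP apos xapos; split=> //.
by rewrite trmx_mul refl_tr -mulmxA refl_self mulmxN heightN oppr_lt0.
Qed.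

Lemma abs_length_free X : {subset X <= Phi} -> free X ->
  abs_length Phi Delta (rprod X) = size X.
Proof.
by move=> XP fX; apply: abs_length_rprod => // L _ /esym; exact: free_rprod_size.
Qed.

End RootSystem.

(** * Fixed spaces and Carter's factorization into independent reflections *)

Lemma generic_point (R : realType) (n m : nat) (Phi : seq 'cV[R]_n)
    (e : 'I_m -> 'cV[R]_n) :
  exists c : 'I_m -> R, forall a, a \in Phi ->
    dotc a (\sum_i c i *: e i) = 0 -> forall i, dotc a (e i) = 0.
Proof.
(* The coefficients lie on the moment curve, [c i = z ^+ i]. The inner product of [a] with the point
   is then the value of [p a] at [z], so [z] only has to avoid the zeros of the finitely many
   nonzero [p a]. *)
pose p (a : 'cV[R]_n) := \poly_(i < m) (if insub i is Some j then dotc a (e j) else 0).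
pose P := \prod_(a <- Phi | p a != 0) p a.
have P0 : P != 0 by rewrite prodf_seq_neq0; apply/allP => a _; apply/implyP.
have [z Pz] : exists z, ~~ root P z.
  apply: contrapT => noz.
  have : (size [seq k%:R : R | k <- iota 0 (size P)] < size P)%N.
    apply: max_poly_roots => //.
      apply/allP => _ /mapP [k _ ->].
      by apply/negPn/negP => Pk; apply: noz; exists k%:R.
    by rewrite map_inj_uniq ?iota_uniq // => i j /eqP; rewrite eqr_nat => /eqP.
  by rewrite size_map size_iota ltnn.
exists (fun i => z ^+ i) => a aP; rewrite dotcC dotc_suml => az i.
have pz : (p a).[z] = 0.
  rewrite horner_poly -[RHS]az; apply: eq_bigr => j _.
  by rewrite valK dotcZl mulrC dotcC.
have pa : p a = 0.
  apply: contraNeq Pz => pa0; rewrite /root horner_prod prodf_seq_eq0.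
  by apply/hasP; exists a => //=; rewrite pa0 pz eqxx.
by have := congr1 (fun q : {poly R} => q`_i) pa; rewrite coef_poly coef0 ltn_ord valK.
Qed.

Lemma refl_image_fix (R : realType) (n : nat) (x : 'M[R]_n) (a v : 'cV[R]_n) :
  x^T *m x = 1%:M -> x *m v = v + a -> a != 0 -> refl a *m (x *m v) = v.
Proof.
(* [x v] and [v] have the same norm and differ by [a]. *)
move=> xx xv a0; have := dotc_orth v v xx.
rewrite xv dotcDr !dotcDl (dotcC v a) => av.
have {}av : 2 * dotc a v = - dotc a a by lra.
rewrite mulmxDr refl_self refl_mul av mulNr divff ?dotc_eq0 //.
by rewrite scaleN1r opprK addrK.
Qed.

(** For orthogonal [x] the kernel of [(x - 1)^T] is the fixed space of [x], and the image of [x - 1]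
    is the orthogonal complement of that kernel. *)
Lemma image_of_perp_fix (R : realType) (n : nat) (x : 'M[R]_n) (a : 'cV[R]_n) :
  x^T *m x = 1%:M ->
  (forall z, x *m z = z -> dotc a z = 0) -> exists v, x *m v = v + a.
Proof.
move=> xx xa; have : (a^T <= (x - 1%:M)^T)%MS.
  rewrite submxE; apply/eqP/rowP => j; set C := cokermx _.
  have fixC : x *m col j C = col j C.
    have : (x - 1%:M)^T *m col j C = 0 by rewrite colE mulmxA mulmx_coker mul0mx.
    rewrite linearB /= trmx1 mulmxBl mul1mx => /subr0_eq xC.
    by rewrite -{1}xC mulmxA (mulmx1C xx) mul1mx.
  have := xa _ fixC; rewrite !mxE => aC; rewrite -[RHS]aC.
  by apply: eq_bigr => l _; rewrite !mxE.
move=> /submxP [D aE]; exists D^T.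
have := congr1 trmx aE; rewrite trmxK trmx_mul trmxK mulmxBl mul1mx => ->.
by rewrite addrC subrK.
Qed.

(** A reflection in the moved space of [x = rprod X] strictly shrinks it. Write [a = x v - v]; then
    [refl a *m v] is fixed by [rprod Y]. Were the spans equal, it would be orthogonal to [a], so [v]
    would be too, and [x v = refl a v = v] would give [a = 0]. *)
Lemma free_rprod_drop (R : realType) (n : nat) (X Y : seq 'cV[R]_n) a :
  free X -> free Y -> a \in <<X>>%VS -> a != 0 ->
  rprod Y = rprod X *m refl a -> (<<Y>> <= <<X>>)%VS /\ (size Y < size X)%N.
Proof.
move=> fX fY aX a0 YE.
have YX : (<<Y>> <= <<X>>)%VS.
  apply: subv_trans (free_rprod_span (L := X ++ [:: a]) fY _) _.
    by rewrite rprod_cat rprod1.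
  by rewrite span_cat subv_add subvv /= span_seq1 -memvE.
split=> //; rewrite ltnNge; apply/negP => XsY.
have /eqP YX' : <<Y>>%VS == <<X>>%VS by rewrite eqEdim YX (eqnP fX) (eqnP fY).
have [v xv] : exists v, rprod X *m v = v + a.
  apply: image_of_perp_fix (rprod_orth X) _ => z /(free_rprod_fix fX).
  exact: span_perp.
have := refl_image_fix (rprod_orth X) xv a0 => axv.
have Yv : rprod Y *m (refl a *m v) = refl a *m v.
  by rewrite YE -mulmxA reflK -{2}axv reflK.
have : dotc a (refl a *m v) = 0.
  by apply: span_perp (free_rprod_fix fY Yv); rewrite YX'.
rewrite -[X in dotc X _](reflK a) refl_self mulmxN dotcNl.
rewrite dotc_orth ?refl_tr ?refl_sqr //.
move=> /eqP; rewrite oppr_eq0 => /eqP av; move: axv.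
move=> /(congr1 (mulmx (refl a))); rewrite reflK refl_perp // xv.
by move=> /eqP; rewrite -subr_eq0 addrC addKr (negPf a0).
Qed.

Section Carter.
Variables (R : realType) (n : nat) (Phi Delta : seq 'cV[R]_n).
Hypothesis hPhi : root_system Phi.
Hypothesis hDelta : simple_system Phi Delta.
Implicit Types (a b d v z : 'cV[R]_n) (x y : 'M[R]_n) (L r : seq 'cV[R]_n).

Local Notation W := (refl_group Phi).
Local Notation h := (height Delta).

(** The first letter of a shortest word for [x^-1] works: otherwise exchange would shorten that
    word. *)
Lemma simple_neg x : W x -> x != 1%:M -> exists2 d, d \in Delta & h (x *m d) < 0.
Proof.
move=> Wx x1; have [[r [rD xE rs]] minr] := cox_lengthP hPhi hDelta (W_tr Wx).
case: r rD xE rs => [|d r] rD xE rs.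
  by case/eqP: x1; rewrite -[x]trmxK xE rprod_nil trmx1.
have dD : d \in Delta by rewrite rD ?mem_head.
have rD' : {subset r <= Delta} by move=> b br; rewrite rD // inE br orbT.
have dP := simple_rootE hDelta dD.
exists d => //; rewrite -[x]trmxK xE rprod_cons trmx_mul refl_tr -mulmxA refl_self.
rewrite mulmxN heightN oppr_lt0; have Wr : W (rprod r).
  by apply: W_rprod => b /rD'/(simple_rootE hDelta).
apply: contraT => neg.
have [||r' [r'D r's r'E]] := exchange hPhi hDelta rD' dP.
- by rewrite (simple_height hDelta dD).
- by rewrite (root_height_lt0 hPhi hDelta) // (W_root hPhi (W_tr Wr)).
have := minr r' r'D (etrans xE (etrans (rprod_cons _ _) r'E)).
by rewrite -rs /= -r's ltnNge leqW.
Qed.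

(** [undup] is there because the list [Phi] may repeat roots, with multiplicities that a reflection
    need not preserve. *)
Lemma perm_refl_roots d : d \in Phi ->
  perm_eq (undup Phi) [seq refl d *m a | a <- undup Phi].
Proof.
move=> dP; have inj : injective (fun a => refl d *m a).
  by move=> a b /(congr1 (mulmx (refl d))); rewrite !reflK.
apply: uniq_perm; rewrite ?undup_uniq ?(map_inj_uniq inj) ?undup_uniq // => a.
rewrite mem_undup; apply/idP/mapP => [aP|[b + ->]]; last first.
  by rewrite mem_undup => bP; exact: root_stable hPhi _ _ dP bP.
by exists (refl d *m a); rewrite ?reflK // mem_undup (root_stable hPhi).
Qed.

(* The number of positive roots negative on [v] drops when [v] is reflected in a
   simple root negative on it, so [v] may be assumed dominant. *)
Lemma stabilizer_root x v : W x -> x != 1%:M -> x *m v = v ->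
  exists2 a, a \in Phi & dotc a v = 0.
Proof.
pose neg v := [pred a | (0 < h a) && (dotc a v < 0)].
have [m] := ubnP (count (neg v) (undup Phi)).
elim: m x v => // m IH x v /ltnSE cm Wx x1 xv.
have [[d dD dv]|dom] := pselect (exists2 d, d \in Delta & dotc d v < 0); last first.
  (* Dominant case: [dotc d v] is nonnegative, and it equals [dotc (x *m d) v], which is nonpositive
     because [x *m d] is a negative root. *)
  have [d dD xd] := simple_neg Wx x1; have dP := simple_rootE hDelta dD.
  have domv a : a \in Phi -> 0 < h a -> 0 <= dotc a v.
    move=> aP apos; have [_ [c [c0 ->]]] := (pos_rootP hPhi hDelta a).2 (conj aP apos).
    rewrite dotc_suml big_seq sumr_ge0 // => b bD; rewrite dotcZl mulr_ge0 ?c0 //.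
    by rewrite leNgt; apply/negP => bv; apply: dom; exists b.
  exists d => //; apply/eqP; rewrite eq_le domv ?(simple_height hDelta dD) // andbT.
  rewrite -(dotc_orth d v (W_orth Wx)) xv -oppr_ge0 -dotcNl domv //.
    by rewrite rootN // (W_root hPhi Wx).
  by rewrite heightN oppr_gt0.
have dP := simple_rootE hDelta dD.
have [||||a aP av] := IH (refl d *m x *m refl d) (refl d *m v).
- apply: leq_trans cm; rewrite (permP (perm_refl_roots dP)) count_map.
  apply: (count_ltn (b := d)); rewrite ?mem_undup //=; first last.
  + by rewrite refl_self heightN (simple_height hDelta dD) oppr_gt0 ltr10.
  + by rewrite (simple_height hDelta dD) ltr01 dv.
  move=> b; rewrite mem_undup => bP /=.
  rewrite dotc_adj refl_tr reflK => /andP [sbpos bv]; rewrite bv andbT.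
  apply: contraT => bneg.
  have [bd|bd] := eqVneq (- b) d.
    by move: dv; rewrite -bd dotcNl oppr_lt0 ltNge ltW.
  have := simple_permutes_pos hPhi hDelta dD (rootN hPhi bP) _ bd.
  rewrite mulmxN !heightN !oppr_gt0 (root_height_lt0 hPhi hDelta) // => /(_ bneg).
  by rewrite ltNge ltW.
- by apply: W_mul; [apply: W_mul|]; rewrite //; exact: W_refl.
- apply: contra_neq x1 => /(congr1 (fun y => refl d *m (y *m refl d))).
  by rewrite mul1mx -!mulmxA reflK refl_sqr mulmx1.
- by rewrite -!mulmxA reflK xv.
exists (refl d *m a); first exact: root_stable hPhi _ _ dP aP.
by rewrite dotc_adj refl_tr.
Qed.

(** [stabilizer_root] is applied to a generic fixed vector: a root orthogonal to that vector is
    orthogonal to the whole fixed space. *)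
Lemma fix_root x : W x -> x != 1%:M ->
  exists2 a, a \in Phi & forall z, x *m z = z -> dotc a z = 0.
Proof.
move=> Wx x1; set K := kermx (x - 1%:M)^T.
have [c cP] := generic_point Phi (fun i => (row i K)^T).
have fixK i : x *m (row i K)^T = (row i K)^T.
  apply/eqP; rewrite -subr_eq0 -{2}[_^T]mul1mx -mulmxBl -[_ - _]trmxK -trmx_mul.
  by rewrite -row_mul mulmx_ker row0 trmx0.
have [|a aP av] := @stabilizer_root x (\sum_i c i *: (row i K)^T) Wx x1.
  by rewrite mulmx_sumr; apply: eq_bigr => i _; rewrite -scalemxAr fixK.
exists a => // z xz; have : (z^T <= K)%MS.
  by apply/sub_kermxP; rewrite -trmx_mul mulmxBl mul1mx xz subrr trmx0.
move=> /submxP [D zE]; rewrite -[z]trmxK zE mulmx_sum_row.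
rewrite linear_sum dotcC dotc_suml big1 // => i _.
by rewrite linearZ dotcZl dotcC cP ?mulr0.
Qed.

(** Induction on the rank of [x - 1]. With [a] from [fix_root] and [x v = v + a], the product
    [refl a *m x] fixes [v] besides all fixed vectors of [x]. If [a] were in the span of the
    remaining roots, [v] would be orthogonal to [a] and so fixed by [x]. *)
Lemma free_reflection_factorization x : W x ->
  exists X, [/\ free X, {subset X <= Phi} & x = rprod X].
Proof.
have [m] := ubnP (\rank (x - 1%:M)).
elim: m x => // m IH x /ltnSE rm Wx.
have [->|x1] := eqVneq x 1%:M; first by exists [::]; rewrite rprod_nil nil_free.
have [a aP xa] := fix_root Wx x1; have a0 := root_neq0 hPhi aP.
have [v xv] := image_of_perp_fix (W_orth Wx) xa.
have axv : refl a *m x *m v = v by rewrite -mulmxA (refl_image_fix (W_orth Wx)).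
have xvv : x *m v != v by rewrite xv -subr_eq0 addrC addKr.
have [||Y [fY YP YE]] := IH (refl a *m x); last 1 first.
- exists (a :: Y); split=> [|b|].
  + rewrite free_cons fY andbT; apply: contra xvv => aY.
    have av : dotc a v = 0.
      by apply: span_perp aY (free_rprod_fix fY _); rewrite -YE.
    by apply/eqP; rewrite -[x *m v](reflK a) (mulmxA _ x) axv refl_perp.
  + by rewrite inE => /predU1P [-> //|/YP].
  + by rewrite rprod_cons -YE reflK.
- apply: leq_trans rm; apply: rank_ltmx; apply/andP; split.
    rewrite submxE; apply/eqP/matrixP => i j.
    set z := col j (cokermx (x - 1%:M)); have xz : x *m z = z.
      have : (x - 1%:M) *m z = 0 by rewrite /z colE mulmxA mulmx_coker mul0mx.
      by rewrite mulmxBl mul1mx => /subr0_eq.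
    have /matrixP/(_ i 0) : (refl a *m x - 1%:M) *m z = 0.
      by rewrite mulmxBl mul1mx -mulmxA xz refl_perp ?subrr // xa.
    by rewrite /z colE mulmxA -colE [LHS]mxE => ->; rewrite !mxE.
  apply: contra xvv => /submxP [D xE]; rewrite -subr_eq0 -{2}[v]mul1mx -mulmxBl.
  by rewrite xE -mulmxA mulmxBl mul1mx axv subrr mulmx0.
- by apply: W_mul => //; exact: W_refl.
Qed.

End Carter.

(** * Inversions of a word and deletion of letters *)

Section InversionRoots.
Variables (R : realType) (n : nat).
Implicit Types (a d : 'cV[R]_n) (r X : seq 'cV[R]_n).

(* The roots alpha_1, ..., alpha_k of the word [r]. *)
Fixpoint inv_roots r : seq 'cV[R]_n :=
  if r is d :: r' then d :: [seq refl d *m a | a <- inv_roots r'] else [::].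

Lemma size_inv_roots r : size (inv_roots r) = size r.
Proof. by elim: r => //= d r IH; rewrite size_map IH. Qed.

Lemma inv_roots_take m r : inv_roots (take m r) = take m (inv_roots r).
Proof. by elim: r m => [|d r IH] [|m] //=; rewrite IH map_take. Qed.

Lemma nth_inv_roots r i : (i < size r)%N ->
  (inv_roots r)`_i = rprod (take i r) *m r`_i.
Proof.
elim: r i => [|d r IH] [|i] //= ir; first by rewrite rprod_nil mul1mx.
by rewrite (nth_map 0) ?size_inv_roots // IH // rprod_cons mulmxA.
Qed.

Lemma rprod_map_refl d X :
  rprod [seq refl d *m a | a <- X] = refl d *m rprod X *m refl d.
Proof.
elim: X => [|a X IH] /=; first by rewrite !rprod_nil mulmx1 refl_sqr.
have dd : (refl d)^T *m refl d = 1%:M by rewrite refl_tr refl_sqr.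
by rewrite !rprod_cons IH refl_conj // refl_tr -!mulmxA reflK.
Qed.

(** Multiplying a word on the left by selected inversion reflections deletes the selected letters;
    this is the recursion on the first letter. *)
Lemma rprod_mask_inv_roots b (m : bitseq) d r :
  rprod (mask (b :: m) (inv_roots (d :: r))) *m rprod (d :: r) =
  (if b then 1%:M else refl d) *m (rprod (mask m (inv_roots r)) *m rprod r).
Proof.
case: b; rewrite /= -map_mask ?rprod_cons rprod_map_refl ?mul1mx.
  by rewrite -!mulmxA !reflK.
by rewrite -!mulmxA reflK.
Qed.

End InversionRoots.

(** * Reduced words and walks under multiplication by a reflection *)

Section Words.
Variables (R : realType) (n : nat) (Phi Delta : seq 'cV[R]_n).
Hypothesis hPhi : root_system Phi.
Hypothesis hDelta : simple_system Phi Delta.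
Implicit Types (a b d g v z : 'cV[R]_n) (x y w : 'M[R]_n) (L r : seq 'cV[R]_n).

Local Notation W := (refl_group Phi).
Local Notation h := (height Delta).
Local Notation walk := (lwalk Delta Phi).

Definition reduced_word r : Prop :=
  {subset r <= Delta} /\
  forall r', {subset r' <= Delta} -> rprod r' = rprod r -> (size r <= size r')%N.

Lemma W_simple_word r : {subset r <= Delta} -> W (rprod r).
Proof. by move=> rD; apply: W_rprod => a /rD/(simple_rootE hDelta). Qed.

Lemma reduced_cat r1 r2 :
  reduced_word (r1 ++ r2) -> reduced_word r1 /\ reduced_word r2.
Proof.
move=> [rD minr].
have r1D : {subset r1 <= Delta} by move=> a a1; rewrite rD // mem_cat a1.
have r2D : {subset r2 <= Delta} by move=> a a2; rewrite rD // mem_cat a2 orbT.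
split; split=> // r' r'D r'E.
  have := minr (r' ++ r2); rewrite !rprod_cat r'E !size_cat leq_add2r; apply=> // a.
  by rewrite mem_cat => /orP [/r'D|/r2D].
have := minr (r1 ++ r'); rewrite !rprod_cat r'E !size_cat leq_add2l; apply=> // a.
by rewrite mem_cat => /orP [/r1D|/r'D].
Qed.

Lemma reduced_cons d r : reduced_word (d :: r) ->
  [/\ d \in Delta, reduced_word r & 0 < h ((rprod r)^T *m d)].
Proof.
move=> red; have [_ redr] := @reduced_cat [:: d] r red.
have [rD minr] := red; have dD : d \in Delta by rewrite rD ?mem_head.
split=> //; have dP := simple_rootE hDelta dD.
apply: contraT => neg.
have [||r' [r'D r's r'E]] := exchange hPhi hDelta redr.1 dP.
- by rewrite (simple_height hDelta dD).
- rewrite (root_height_lt0 hPhi hDelta) // (W_root hPhi) //.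
  exact: W_tr (W_simple_word redr.1).
by have := minr r' r'D; rewrite rprod_cons r'E /= -r's ltnNge leqW //; apply.
Qed.

(** Since [refl d] permutes the positive roots other than [d], the inversions of [d :: r] are [d]
    and the images of those of [r]; reducedness keeps [d] out of the latter. *)
Lemma inv_roots_spec r : reduced_word r ->
  (forall a, a \in inv_roots r -> a \in Phi /\ 0 < h a) /\
  (forall a, a \in Phi -> 0 < h a ->
     (a \in inv_roots r) = (h ((rprod r)^T *m a) < 0)).
Proof.
elim: r => [_|d r IH red] /=.
  by split=> // a aP apos; rewrite rprod_nil trmx1 mul1mx ltNge ltW.
have [dD redr dpos] := reduced_cons red; have [pos mem] := IH redr.
have dP := simple_rootE hDelta dD.
have dh : 0 < h d by rewrite (simple_height hDelta dD).
have dr : d \notin inv_roots r by rewrite mem // -leNgt ltW.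
split=> a; first rewrite inE => /predU1P [-> //|/mapP [b br ->]].
  have [bP bpos] := pos b br; split; first exact: root_stable hPhi _ _ dP bP.
  by apply: (simple_permutes_pos hPhi hDelta) => //; apply: contraNneq dr => <-.
move=> aP apos; rewrite rprod_cons trmx_mul refl_tr -mulmxA inE.
have [->|ad] /= := eqVneq a d.
  by rewrite refl_self mulmxN heightN oppr_lt0 dpos.
rewrite -mem ?(root_stable hPhi) ?(simple_permutes_pos hPhi hDelta) //.
rewrite -{1}[a](reflK d) mem_map // => e f /(congr1 (mulmx (refl d))).
by rewrite !reflK.
Qed.

Lemma walk_rcons_simple L d x y : d \in Delta -> 0 < h (y^T *m d) ->
  walk L x y -> walk (rcons L d) x (refl d *m y).
Proof.
move=> dD ypos /walk_cat; rewrite -cats1; apply=> /=; split=> //.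
by apply/and3P; rewrite (simple_rootE hDelta) // (simple_height hDelta dD).
Qed.

Lemma edge_simple d x a : d \in Delta -> a != d ->
  pos_label Delta Phi x a -> pos_label Delta Phi (refl d *m x) (refl d *m a).
Proof.
move=> dD ad /and3P [aP apos xapos]; apply/and3P; split.
- by rewrite (root_stable hPhi) // (simple_rootE hDelta).
- exact: (simple_permutes_pos hPhi hDelta).
- by rewrite trmx_mul refl_tr -mulmxA reflK.
Qed.

Lemma refl_mul_conj d a x :
  refl (refl d *m a) *m (refl d *m x) = refl d *m (refl a *m x).
Proof.
have dd : (refl d)^T *m refl d = 1%:M by rewrite refl_tr refl_sqr.
by rewrite refl_conj // refl_tr -!mulmxA reflK.
Qed.

(** Left multiplication by [refl d] carries an edge labelled [a] to one labelled [refl d *m a],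
    unless [a = d]. Such an edge is contracted, and the rest of the walk is kept unchanged. *)
Lemma walk_simple_up d L x y : d \in Delta -> walk L x y ->
  (exists2 L', size L' = size L & walk L' (refl d *m x) (refl d *m y)) \/
  (exists2 L', (size L').+1 = size L & walk L' (refl d *m x) y).
Proof.
move=> dD; elim: L x => [|a L IH] x /=; first by move=> ->; left; exists [::].
move=> [xa Lw]; have [ad|ad] := eqVneq a d.
  by right; exists L; rewrite -?ad.
have da := edge_simple dD ad xa.
case: (IH _ Lw) => -[L' L's L'w]; [left|right]; exists (refl d *m a :: L');
  by rewrite /= ?L's // refl_mul_conj.
Qed.

(** A deleted letter [d] costs one final edge labelled [d]. For a kept letter the walk is multiplied
    by [refl d]; if this contracts an edge, a final edge labelled [d] restores both length and
    endpoint. *)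
Lemma subword_walk r (m : bitseq) : reduced_word r -> size m = size r ->
  exists2 L, size L = count id m &
    walk L (rprod (mask m (inv_roots r)) *m rprod r) (rprod r).
Proof.
elim: r m => [|d r IH] [|b m] // red.
  by exists [::]; rewrite //= rprod_nil mulmx1.
have [dD redr dpos] := reduced_cons red => -[ms].
have [L Ls Lw] := IH m redr ms; rewrite rprod_mask_inv_roots rprod_cons.
case: b => /=.
  exists (rcons L d); first by rewrite size_rcons Ls.
  by rewrite mul1mx; exact: walk_rcons_simple.
rewrite add0n -Ls; case: (walk_simple_up dD Lw) => -[L' L's L'w]; first by exists L'.
exists (rcons L' d); first by rewrite size_rcons L's.
exact: walk_rcons_simple.
Qed.

(** The analogue of [walk_simple_up] on the right, with [b] simple only relative to [U]. All labels
    lie in [V], so the roots [x^-1 a] stay in [U] along the walk; an edge with [x^-1 a = b] is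
    contracted. *)
Lemma walk_refl_right (V : {vspace 'cV[R]_n}) (U : 'cV[R]_n -> Prop) b L x y :
  (forall g, g \in Phi -> U g -> 0 < h g -> g != b -> 0 < h (refl b *m g)) ->
  W x -> {subset L <= V} -> (forall v, v \in V -> U (x^T *m v)) -> walk L x y ->
  (exists L', walk L' (x *m refl b) (y *m refl b)) \/
  (exists L', walk L' (x *m refl b) y).
Proof.
move=> Ub; elim: L x => [|a L IH] x Wx LV xU /=; first by move=> ->; left; exists [::].
move=> [/and3P [aP apos xapos] Lw].
have aV : a \in V by rewrite LV ?mem_head.
have [ab|ab] := eqVneq (x^T *m a) b.
  right; exists L; rewrite -ab refl_conj; last by rewrite trmxK (W_orthr Wx).
  by rewrite trmxK !mulmxA (W_orthr Wx) mul1mx.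
have xb : pos_label Delta Phi (x *m refl b) a.
  apply/and3P; split=> //; rewrite trmx_mul refl_tr -mulmxA.
  by apply: Ub => //; [exact: W_root (W_tr Wx) aP|exact: xU].
have LV' : {subset L <= V} by move=> e eL; rewrite LV // inE eL orbT.
have xU' v : v \in V -> U ((refl a *m x)^T *m v).
  move=> vV; rewrite trmx_mul refl_tr -mulmxA; apply: xU.
  by rewrite refl_mul memvB // memvZ.
case: (IH _ (W_mul (W_refl aP) Wx) LV' xU' Lw) => -[L' L'w]; [left|right];
  by exists (a :: L') => /=; rewrite mulmxA.
Qed.

(* The last inversion of [w] in [V] becomes a simple root of the subsystem
   [w^-1 V]. *)
Lemma last_inversion_simple r (c : nat) (V : {vspace 'cV[R]_n}) g :
  let w := rprod r in let b := - (w^T *m (inv_roots r)`_c) in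
  reduced_word r -> (c < size r)%N -> (inv_roots r)`_c \in V ->
  (forall i, (i < size r)%N -> (inv_roots r)`_i \in V -> (i <= c)%N) ->
  g \in Phi -> w *m g \in V -> 0 < h g -> g != b -> 0 < h (refl b *m g).
Proof.
move=> w b red cr; set al := nth 0 _ c => alV cmax gP wgV gpos gb.
have Ww : W w := W_simple_word red.1.
have [pos mem] := inv_roots_spec red.
have alr : al \in inv_roots r by rewrite mem_nth ?size_inv_roots.
have [alP alpos] := pos _ alr.
have bP : b \in Phi by rewrite rootN // (W_root hPhi) //; exact: W_tr.
have bpos : 0 < h b by rewrite heightN oppr_gt0 -mem.
have wb : w *m b = - al by rewrite mulmxN mulmxA (W_orthr Ww) mul1mx.
have redc : reduced_word (take c r).
  by apply: (@reduced_cat _ (drop c r) _).1; rewrite cat_take_drop.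
set y := rprod (take c r); have Wy : W y := W_simple_word redc.1.
have [posc memc] := inv_roots_spec redc.
(* [al] is the image under [y] of the simple root of the letter at index [c]. *)
have yal : h (y^T *m al) = 1.
  rewrite /al nth_inv_roots // mulmxA rprod_orth mul1mx (simple_height hDelta) //.
  by rewrite red.1 // mem_nth.
(* Inversions of [y] are inversions of [w], and the inversions of [w] in [V] other than [al] come
   before index [c], so they are inversions of [y]. *)
have prefix G : G \in Phi -> G \in V -> 0 < h (w^T *m G) -> G != - al ->
    0 < h (y^T *m G).
  move=> GP GV wG Gal; have yGP := W_root hPhi (W_tr Wy) GP.
  have [Gpos|Gneg] := boolP (0 < h G).
    apply: contraT; rewrite -(root_height_lt0 hPhi hDelta) // -memc // => Gc.
    have : G \in inv_roots r by move: Gc; rewrite inv_roots_take => /mem_take.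
    by rewrite mem // ltNge ltW.
  have NGP := rootN hPhi GP.
  have NGpos : 0 < h (- G) by rewrite heightN oppr_gt0 (root_height_lt0 hPhi hDelta).
  have : - G \in inv_roots r by rewrite mem // mulmxN heightN oppr_lt0.
  move=> /(nthP 0) [i]; rewrite size_inv_roots => ir GE.
  have ic : (i <= c)%N by apply: cmax; rewrite // GE memvN.
  have {}ic : (i < c)%N.
    rewrite ltn_neqAle ic andbT; apply: contraNneq Gal => ic'.
    by rewrite /al -ic' GE opprK.
  have : - G \in inv_roots (take c r).
    rewrite inv_roots_take -GE -(nth_take 0 ic) mem_nth //.
    by rewrite size_take size_inv_roots cr.
  by rewrite memc // mulmxN heightN oppr_lt0.
(* Otherwise [g] and [e] are positive roots with sum [k *: b], [k > 0]. By [prefix] both [y^-1 w g]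
   and [y^-1 w e] are positive, yet their sum [- k *: (y^-1 al)] has height [- k]. *)
apply: contraT => neg; pose e := - (refl b *m g).
have bgP := root_stable hPhi bP gP.
have eP : e \in Phi by rewrite rootN.
have epos : 0 < h e by rewrite heightN oppr_gt0 (root_height_lt0 hPhi hDelta).
pose k := 2 * dotc b g / dotc b b.
have geE : g + e = k *: b by rewrite /e refl_mul opprB addrC subrK.
have kpos : 0 < k.
  by have := addr_gt0 gpos epos; rewrite -heightD geE heightZ pmulr_lgt0.
have wge : w *m g + w *m e = - (k *: al) by rewrite -mulmxDr geE -scalemxAr wb scalerN.
have weV : w *m e \in V.
  have -> : w *m e = - (k *: al) - w *m g by rewrite -wge addrC addKr.
  by rewrite memvB // memvN memvZ.
have wK v : w^T *m (w *m v) = v by rewrite mulmxA (W_orth Ww) mul1mx.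
have yg : 0 < h (y^T *m (w *m g)).
  apply: prefix; rewrite ?(W_root hPhi Ww) ?wK //.
  by apply: contra_neq gb; rewrite -wb => /(congr1 (mulmx w^T)); rewrite !wK.
have ye : 0 < h (y^T *m (w *m e)).
  apply: prefix; rewrite ?(W_root hPhi Ww) ?wK //.
  apply: contra_neq gb; rewrite -wb => /(congr1 (mulmx w^T)); rewrite !wK => eb.
  by rewrite -[g](reflK b) -[refl b *m g]opprK -/e eb mulmxN refl_self opprK.
have := addr_gt0 yg ye; rewrite -heightD -mulmxDr wge mulmxN -scalemxAr.
rewrite heightN heightZ yal.
by rewrite mulr1 oppr_gt0 ltNge ltW.
Qed.

End Words.

(** * NBC sets: independence, injectivity and adjoining a largest index *)

Section BrokenCircuits.
Import fintype boot.finset.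
Variables (R : realType) (n k : nat) (alpha : 'I_k -> 'cV[R]_n).
Implicit Types (A B C : {set 'I_k}) (c i j m : 'I_k).

Local Notation roots A := [seq alpha i | i <- enum A].

Definition nbc A : Prop := forall B, broken_circuit alpha B -> ~~ (B \subset A).

Lemma nbc_sub A B : A \subset B -> nbc B -> nbc A.
Proof. by move=> AB nB C /nB; apply: contra => CA; exact: subset_trans CA AB. Qed.

Lemma perm_roots_setD1 A c : c \in A ->
  perm_eq (roots A) (alpha c :: roots (A :\ c)).
Proof.
move=> cA; rewrite -[_ :: _]/(map alpha (c :: enum (A :\ c))); apply: perm_map.
apply: uniq_perm; rewrite /= ?enum_uniq ?mem_enum ?setD11 // => i.
by rewrite inE !mem_enum !inE; case: eqVneq => // ->.
Qed.

Lemma circuit_span C m : circuit alpha C -> m \in C ->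
  alpha m \in <<roots (C :\ m)>>%VS.
Proof.
move=> /minsetP [Cdep Cmin] mC.
have : free (roots (C :\ m)).
  apply: contraT => dep; have CE := Cmin _ dep (subsetDl _ _).
  by move: mC; rewrite -CE setD11.
move: Cdep; rewrite (perm_free (perm_roots_setD1 mC)) free_cons => + fC.
by rewrite fC andbT negbK.
Qed.

Lemma dependent_broken_circuit A : ~~ free (roots A) ->
  exists C m, [/\ C \subset A, m \in C, (forall j, j \in C -> (j <= m)%N) &
                  broken_circuit alpha (C :\ m)].
Proof.
move=> Adep; have [C Cc CA] := minset_exists (P := fun A => ~~ free (roots A)) Adep.
have [i iC] : exists i, i \in C.
  apply/set0Pn; apply/eqP => C0; move/minsetP: Cc => [+ _].
  by rewrite C0 enum_set0 /= nil_free.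
case: (arg_maxnP (P := mem C) (fun j => j : nat) iC) => m mC mmax.
by exists C, m; split=> //; exists C, m.
Qed.

Lemma nbc_free A : nbc A -> free (roots A).
Proof.
move=> nA; apply: contraT => /dependent_broken_circuit [C [m [CA _ _ /nA]]].
by rewrite (subset_trans _ CA) ?subsetDl.
Qed.

(** A dependence would give a circuit inside [c |: A]. Removing its largest index leaves a subset of
    [A], as [c] exceeds the indices of [A]: a broken circuit in [A]. *)
Lemma nbc_notin_span A c : nbc A -> c \notin A ->
  (forall j, j \in A -> (j <= c)%N) -> alpha c \notin <<roots A>>%VS.
Proof.
move=> nA cA cmax; apply/negP => cspan.
have : ~~ free (roots (c |: A)).
  by rewrite (perm_free (perm_roots_setD1 (setU11 c A))) setU1K // free_cons cspan.
move=> /dependent_broken_circuit [C [m [CA mC mmax /nA/negP[]]]]; apply/subsetP => j.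
rewrite in_setD1 => /andP [jm jC].
have := subsetP CA j jC; rewrite in_setU1 => /predU1P [jc|//].
have := subsetP CA m mC; rewrite in_setU1 => /predU1P [mc|mA].
  by rewrite jc mc eqxx in jm.
case/eqP: jm; apply/val_inj/eqP; rewrite eqn_leq mmax //= jc cmax //.
Qed.

Lemma enum_rcons_max A c : c \in A -> (forall j, j \in A -> (j <= c)%N) ->
  enum A = rcons (enum (A :\ c)) c.
Proof.
move=> cA cmax; pose lt (i j : 'I_k) := (i < j)%N.
have lt_tr : transitive lt by move=> i j l; exact: ltn_trans.
have srt B : sorted lt (enum B).
  rewrite {1}/enum_mem -enumT; apply: sorted_filter => //.
  by have := iota_ltn_sorted 0 k; rewrite -val_enum_ord sorted_map.
apply: (irr_sorted_eq lt_tr) => //; first by move=> i; exact: ltnn.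
  rewrite (sorted_pairwise lt_tr) pairwise_rcons -(sorted_pairwise lt_tr) srt andbT.
  apply/allP => j; rewrite mem_enum !inE => /andP [jc jA].
  by rewrite /lt ltn_neqAle cmax // andbT.
move=> j; rewrite mem_rcons inE !mem_enum !inE.
by case: eqVneq => // ->.
Qed.

Lemma rprod_roots_max A c : c \in A -> (forall j, j \in A -> (j <= c)%N) ->
  rprod (roots A) = rprod (roots (A :\ c)) *m refl (alpha c).
Proof.
move=> cA cmax; rewrite (enum_rcons_max cA cmax) map_rcons -cats1 rprod_cat.
by rewrite rprod1.
Qed.

(** Equal products put the independent roots of [B] in the span of those of [A], which
    [nbc_notin_span] forbids for [alpha c] when [c] is missing from [A]. *)
Lemma nbc_max_in A B c : nbc A -> nbc B -> rprod (roots A) = rprod (roots B) ->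
  (forall j, j \in A -> (j <= c)%N) -> c \in B -> c \in A.
Proof.
move=> nA nB AB cmax cB; apply: contraT => /(nbc_notin_span nA) /(_ cmax).
move=> /negP[]; apply: (subvP (free_rprod_span (nbc_free nB) (esym AB))).
by rewrite memv_span // map_f // mem_enum.
Qed.

(** The largest index of the union lies in both sets and gives the last factor of both products;
    cancel it and induct. *)
Lemma nbc_rprod_inj A B : nbc A -> nbc B ->
  rprod (roots A) = rprod (roots B) -> A = B.
Proof.
have [N] := ubnP #|A|; elim: N A B => // N IH A B /ltnSE AN nA nB AB.
have [AB0|/set0Pn [i iAB]] := eqVneq (A :|: B) set0.
  by move/eqP: AB0; rewrite setU_eq0 => /andP [/eqP-> /eqP->].
case: (arg_maxnP (P := mem (A :|: B)) (fun j => j : nat) iAB) => c cAB cmax.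
have cmaxA j : j \in A -> (j <= c)%N by move=> jA; apply: cmax; rewrite inE /= inE jA.
have cmaxB j : j \in B -> (j <= c)%N.
  by move=> jB; apply: cmax; rewrite inE /= inE jB orbT.
have [cA cB] : c \in A /\ c \in B.
  have := cAB; rewrite inE /= inE => /orP [cA|cB]; split=> //.
    exact: (nbc_max_in nB nA).
  exact: (nbc_max_in nA nB).
rewrite -(setD1K cA) -(setD1K cB); congr (_ |: _); apply: IH.
- by apply: leq_trans AN; rewrite [X in (_ < X)%N](cardsD1 c) cA.
- exact: nbc_sub (subsetDl _ _) nA.
- exact: nbc_sub (subsetDl _ _) nB.
have := AB; rewrite (rprod_roots_max cA cmaxA) (rprod_roots_max cB cmaxB).
by move=> /(congr1 (mulmx^~ (refl (alpha c)))); rewrite -!mulmxA refl_sqr !mulmx1.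
Qed.

Lemma nbc_set0 : (forall i, alpha i != 0) -> nbc set0.
Proof.
move=> a0 B [C [m [Cc mC _ ->]]]; apply/negP; rewrite subset0 => /eqP C0.
have := circuit_span Cc mC; rewrite C0 enum_set0 /= span_nil memv0.
by rewrite (negPf (a0 m)).
Qed.

(** A broken circuit in [c |: A] contains [c]. The removed index [m] of its circuit satisfies
    [alpha m \in V] by dependence, so [m <= c], against the maximality of [m]. *)
Lemma nbc_setU1_max (V : {vspace 'cV[R]_n}) A c : nbc A ->
  (forall j, j \in c |: A -> alpha j \in V) ->
  (forall j, alpha j \in V -> (j <= c)%N) -> nbc (c |: A).
Proof.
move=> nA AV cmax B Bb; apply/negP => BA.
have cB : c \in B.
  apply: contraT => cB; have /negP[] := nA _ Bb; apply/subsetP => j jB.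
  have := subsetP BA j jB; rewrite in_setU1 => /predU1P [jc|//].
  by rewrite -jc jB in cB.
have [C [m [Cc mC mmax BE]]] := Bb.
have mc : (m <= c)%N.
  apply: cmax; apply: subvP (circuit_span Cc mC); apply/span_subvP => _ /mapP [j + ->].
  by rewrite mem_enum -BE => /(subsetP BA)/AV.
move: cB; rewrite BE !inE => /andP [/eqP cm cC]; apply: cm; apply: val_inj.
by apply/eqP; rewrite eqn_leq mmax.
Qed.

(** Translates index sets into the bit masks of [subword_walk]. *)
Lemma roots_mask A (al : seq 'cV[R]_n) :
  size al = k -> alpha = (fun i : 'I_k => al`_i) ->
  roots A = mask [seq i \in A | i <- enum 'I_k] al.
Proof.
move=> alk ->; rewrite {1}/enum_mem -enumT filter_mask map_mask.
congr mask.
rewrite (map_comp (nth 0 al) val) val_enum_ord -alk; exact: mkseq_nth.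
Qed.

Lemma count_set_mask A : count id [seq i \in A | i <- enum 'I_k] = #|A|.
Proof. by rewrite count_map cardE {2}/enum_mem -enumT size_filter. Qed.

End BrokenCircuits.

(** * Elements below a reduced word and their NBC sets *)

Section ReducedExpression.
Variables (R : realType) (n : nat) (Phi Delta : seq 'cV[R]_n).
Hypothesis hPhi : root_system Phi.
Hypothesis hDelta : simple_system Phi Delta.
Implicit Types (a b d v z : 'cV[R]_n) (x y : 'M[R]_n) (L X : seq 'cV[R]_n).

Local Notation W := (refl_group Phi).
Local Notation h := (height Delta).
Local Notation walk := (lwalk Delta Phi).

Lemma reduced_expr_word (w : 'M[R]_n) (k : nat) (s : k.-tuple 'M[R]_n) :
  refl_group Phi w -> reduced_expr Delta w s ->
  exists r, [/\ reduced_word Delta r, size r = k, w = rprod r &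
                s = [seq refl a | a <- r] :> seq _].
Proof.
move=> Ww [sD wE wk]; have [|r rD sE] := @map_refl_ex _ _ (fun a => a \in Delta) s.
  by move=> t /tnthP [i ->]; case: (sD i) => a; exists a.
have rk : size r = k by rewrite -(size_map (@refl R n)) -sE size_tuple.
exists r; split=> //; last by rewrite wE sE.
split=> // r' r'D r'E; rewrite rk -wk.
by apply: (cox_lengthP hPhi hDelta Ww).2 => //; rewrite r'E wE sE.
Qed.

Lemma inv_refl_roots (k : nat) (s : k.-tuple 'M[R]_n) (r : seq 'cV[R]_n) (i : 'I_k) :
  s = [seq refl a | a <- r] :> seq _ -> inv_refl s i = refl (inv_roots r)`_i.
Proof.
move=> sE; have ir : (i < size r)%N by rewrite -(size_map (@refl R n)) -sE size_tuple.
rewrite /inv_refl sE -!map_take -map_rev -map_cat -[LHS]/(rprod _).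
rewrite rprod_cat rprod_rev (take_nth 0 ir) -cats1 rprod_cat rprod1.
by rewrite nth_inv_roots // refl_conj ?rprod_orth.
Qed.

Section Fixed.
Variable r : seq 'cV[R]_n.
Hypothesis red : reduced_word Delta r.
Let k := size r.
Let w := rprod r.
Let alpha := fun i : 'I_k => (inv_roots r)`_i.
Local Notation roots A := [seq alpha i | i <- enum (A : {set 'I_k})].

Lemma W_w : W w.
Proof. exact: (W_simple_word hDelta) red.1. Qed.

Lemma alpha_mem i : alpha i \in inv_roots r.
Proof. by rewrite mem_nth ?size_inv_roots. Qed.

Lemma alpha_root i : alpha i \in Phi.
Proof.
by have [pos _] := inv_roots_spec hPhi hDelta red; case: (pos _ (alpha_mem i)).
Qed.

Lemma sub_roots (A : {set 'I_k}) : {subset roots A <= Phi}.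
Proof. by move=> _ /mapP [i _ ->]; exact: alpha_root. Qed.

Lemma set_walk (A : {set 'I_k}) :
  exists2 L, size L = #|A| & walk L (rprod (roots A) *m w) w.
Proof.
rewrite (roots_mask _ (size_inv_roots r)) // -count_set_mask.
by apply: (subword_walk hPhi hDelta red); rewrite size_map size_enum_ord.
Qed.

Lemma mulmxr_w_inj x y : x *m w = y *m w -> x = y.
Proof.
move=> /(congr1 (mulmx^~ w^T)); rewrite -!mulmxA.
by rewrite (W_orthr W_w) !mulmx1.
Qed.

Lemma mulmx_w_inv x : x *m w *m invmx w = x.
Proof. by rewrite (invmx_W W_w) -mulmxA (W_orthr W_w) mulmx1. Qed.

Lemma lower_intervalP u :
  lower_interval Phi Delta w u <-> W u /\ exists L, walk L u w.
Proof.
split=> -[Wu]; first by move/(bruhat_leP hPhi hDelta _ Wu).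
by move=> Lw; split=> //; apply/(bruhat_leP hPhi hDelta _ Wu).
Qed.

Lemma bruhat_distP u L : W u -> walk L u w ->
  (exists2 L', size L' = bruhat_dist Phi Delta u w & walk L' u w) /\
  (forall L', walk L' u w -> (bruhat_dist Phi Delta u w <= size L')%N).
Proof.
move=> Wu Lw; have walkP L' : walk L' u w -> bruhat_walk Phi Delta (size L') u w.
  by move=> L'w; apply/(bruhat_walkP hPhi hDelta _ _ Wu); exists L'.
have [/(bruhat_walkP hPhi hDelta _ _ Wu) wd mind] :=
  min_nat_spec (P := [set m | bruhat_walk Phi Delta m u w]) (walkP _ Lw).
by split=> // L' /walkP/mind.
Qed.

(** Deleting the letters of [A] gives a walk with [#|A|] edges; conversely the labels of any walk
    factor the same element, and an independent factorization is shortest. *)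
Lemma bruhat_dist_free (A : {set 'I_k}) : free (roots A) ->
  bruhat_dist Phi Delta (rprod (roots A) *m w) w =
  abs_length Phi Delta (rprod (roots A) *m w *m invmx w).
Proof.
move=> fA; have [L Ls Lw] := set_walk A.
have WA : W (rprod (roots A) *m w) by apply: W_mul W_w; exact: W_rprod (@sub_roots A).
rewrite mulmx_w_inv (abs_length_free hPhi hDelta (@sub_roots A) fA) size_map -cardE.
have [[L' L's L'w] mind] := bruhat_distP WA Lw.
apply/eqP; rewrite eqn_leq -{1}Ls mind //= -L's cardE -(size_map alpha).
by rewrite (free_rprod_size fA) //; apply: mulmxr_w_inj; exact: walk_rprod L'w.
Qed.

(* Lifting property in the reflection subgroup of the roots in [V]. *)
Lemma walk_drop_last_inversion (V : {vspace 'cV[R]_n}) L (c : 'I_k) :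
  {subset L <= V} -> alpha c \in V -> (forall i, alpha i \in V -> (i <= c)%N) ->
  walk L (rprod L *m w) w ->
  exists L', walk L' (rprod L *m refl (alpha c) *m w) w.
Proof.
move=> LV cV cmax Lw; have LP := walk_roots Lw.
(* The positive root of [w^-1 t_c w]; the sign comes from [alpha c] being an inversion of [w]. *)
pose b := - (w^T *m alpha c).
have wb : w *m refl b = refl (alpha c) *m w.
  rewrite reflN refl_conj; last by rewrite trmxK (W_orthr W_w).
  by rewrite trmxK !mulmxA (W_orthr W_w) mul1mx.
have [_ apos] : alpha c \in Phi /\ 0 < h (alpha c).
  by have [pos _] := inv_roots_spec hPhi hDelta red; exact: pos (alpha_mem c).
have wac : h (w^T *m alpha c) < 0.
  have [_ mem] := inv_roots_spec hPhi hDelta red.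
  by rewrite -mem ?alpha_root ?alpha_mem.
rewrite -mulmxA -wb mulmxA.
have simple_b g : g \in Phi -> w *m g \in V -> 0 < h g -> g != b ->
    0 < h (refl b *m g).
  apply: (last_inversion_simple hPhi hDelta) => //.
  by move=> i ir; exact: (cmax (Ordinal ir)).
have coset v : v \in V -> w *m ((rprod L *m w)^T *m v) \in V.
  move=> vV; rewrite trmx_mul -mulmxA mulmxA (W_orthr W_w) mul1mx -rprod_rev.
  rewrite -[X in X \in V](subrK v) memvD //.
  apply: subvP (rprod_subr_span _ _); apply/span_subvP => a.
  by rewrite mem_rev; exact: LV.
case: (walk_refl_right hPhi simple_b (W_mul (W_rprod LP) W_w) LV coset Lw) => //.
(* With no edge contracted the walk ends at [t_c w]; one more edge, labelled [alpha c], leads up to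
   [w]. *)
move=> [L' L'w]; exists (rcons L' (alpha c)); rewrite -cats1.
apply: walk_cat L'w _ => /=; rewrite wb reflK; split=> //.
apply/and3P; rewrite alpha_root apos; split=> //.
by rewrite trmx_mul refl_tr -mulmxA refl_self mulmxN heightN oppr_gt0.
Qed.

Hypothesis dist_eq_abs : forall u, lower_interval Phi Delta w u ->
  bruhat_dist Phi Delta u w = abs_length Phi Delta (u *m invmx w).

(** By [dist_eq_abs] a shortest walk has [size X] labels. Their span contains that of [X], so
    equality follows by dimension. *)
Lemma minimal_walk X : free X -> {subset X <= Phi} ->
  (exists L, walk L (rprod X *m w) w) ->
  exists L, [/\ walk L (rprod X *m w) w, size L = size X, rprod L = rprod X &
                <<L>>%VS = <<X>>%VS].
Proof.
move=> fX XP [L0 L0w]; have WX : W (rprod X *m w) := W_mul (W_rprod XP) W_w.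
have [[L Ls Lw] _] := bruhat_distP WX L0w.
have LX : rprod L = rprod X by apply: mulmxr_w_inj; rewrite -(walk_rprod Lw).
have {}Ls : size L = size X.
  rewrite Ls dist_eq_abs ?mulmx_w_inv ?(abs_length_free hPhi hDelta) //.
  by apply/lower_intervalP; split=> //; exists L0.
exists L; split=> //; apply/esym/eqP.
rewrite eqEdim (free_rprod_span fX (esym LX)) (eqnP fX) -Ls; exact: dim_span.
Qed.

Lemma nbc_exists X : free X -> {subset X <= Phi} ->
  (exists L, walk L (rprod X *m w) w) ->
  exists2 A : {set 'I_k}, nbc alpha A & rprod (roots A) = rprod X.
Proof.
have [N] := ubnP (size X); elim: N X => // N IH X /ltnSE XN fX XP Xw.
have a0 i : alpha i != 0 := root_neq0 hPhi (alpha_root i).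
have [X0|X0] := eqVneq X [::].
  exists finset.set0; first exact: nbc_set0.
  by rewrite X0 finset.enum_set0.
have [L [Lw Ls LX LV]] := minimal_walk fX XP Xw.
set V := <<X>>%VS in LV.
(* The last label of the nonempty walk [L] is an inversion of [w] in [V]. *)
have [i0 i0V] : exists i, alpha i \in V.
  case/lastP: L Lw Ls LX LV => [|L a] Lw Ls LX LV.
    by rewrite (size0nil (esym Ls)) in X0.
  have [aP apos wa] := walk_last Lw; have [_ mem] := inv_roots_spec hPhi hDelta red.
  have /(nthP 0) [i] : a \in inv_roots r by rewrite mem.
  rewrite size_inv_roots => ir aE; exists (Ordinal ir).
  by rewrite /alpha /= aE -LV memv_span // mem_rcons mem_head.
case: (arg_maxnP (P := fun i => alpha i \in V) (fun j => j : nat) i0V) => c cV cmax.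
have {}cmax i : alpha i \in V -> (i <= c)%N by exact: cmax.
have [L' L'w] : exists L', walk L' (rprod X *m refl (alpha c) *m w) w.
  rewrite -LX; apply: (@walk_drop_last_inversion V) => //; last by rewrite LX.
  by move=> a aL; rewrite -LV memv_span.
have [Y [fY YP YE]] : exists Y,
    [/\ free Y, {subset Y <= Phi} & rprod X *m refl (alpha c) = rprod Y].
  apply: (free_reflection_factorization hPhi hDelta).
  by apply: W_mul (W_rprod XP) _; exact: W_refl (alpha_root c).
have [YX Ysize] := free_rprod_drop fX fY cV (a0 c) (esym YE).
have [||A nA AE] := IH Y _ fY YP.
- exact: leq_trans Ysize XN.
- by exists L'; rewrite -YE.
have AV j : j \in A -> alpha j \in V.
  move=> jA; apply: (subvP YX).
  apply: (subvP (free_rprod_span (nbc_free nA) AE)).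
  by rewrite memv_span // map_f // mem_enum.
have cancel x : x *m refl (alpha c) *m refl (alpha c) = x.
  by rewrite -mulmxA refl_sqr mulmx1.
(* No index of [A] exceeds [c], so toggling [c] multiplies the product on the right by
   [refl (alpha c)], which undoes the passage from [X] to [Y]. *)
have [cA|cA] := boolP (c \in A).
  exists (A :\ c)%SET; first exact: nbc_sub (finset.subsetDl _ _) nA.
  rewrite -[LHS]cancel -rprod_roots_max // => [|j /AV/cmax //].
  by rewrite AE -YE cancel.
have cAV j : j \in (c |: A)%SET -> alpha j \in V.
  by rewrite finset.in_setU1 => /predU1P [->|/AV].
exists (c |: A)%SET; first exact: nbc_setU1_max cAV cmax.
rewrite (rprod_roots_max alpha (finset.setU11 c A)) => [|j /cAV/cmax //].
by rewrite finset.setU1K // AE -YE cancel.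
Qed.

End Fixed.
End ReducedExpression.

(** * Surjectivity of the NBC map against directed distance *)

Theorem theorem3p2 (R : realType) (n : nat) (Phi Delta : seq 'cV[R]_n)
    (hPhi : root_system Phi) (hDelta : simple_system Phi Delta)
    (w : 'M[R]_n) (hw : refl_group Phi w)
    (k : nat) (s : k.-tuple 'M[R]_n) (hs : reduced_expr Delta w s) :
  set_fun (NBC Phi Delta s) (lower_interval Phi Delta w) (nbc_map w s) /\
  (set_surj (NBC Phi Delta s) (lower_interval Phi Delta w) (nbc_map w s) <->
   (forall u : 'M[R]_n, lower_interval Phi Delta w u ->
      bruhat_dist Phi Delta u w = abs_length Phi Delta (u *m invmx w))) /\
  (set_surj (NBC Phi Delta s) (lower_interval Phi Delta w) (nbc_map w s) ->
   set_bij (NBC Phi Delta s) (lower_interval Phi Delta w) (nbc_map w s)).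
Proof.
have [r [red rk wE sE]] := reduced_expr_word hPhi hDelta hw hs.
move: s sE {hs hw}; rewrite wE -rk => s sE {w wE k rk}.
pose alpha (i : 'I_(size r)) := (inv_roots r)`_i.
(* A reflection has only one positive root, so [root_of] returns [alpha i] and not its default 0. *)
have inv_rootE : inv_root Phi Delta s = alpha.
  apply: funext => i; rewrite /inv_root /root_of (inv_refl_roots i sE).
  have [pos _] := inv_roots_spec hPhi hDelta red.
  have [aP apos] := pos _ (alpha_mem i).
  case: xgetP => [b -> [/(pos_rootP hPhi hDelta) [bP bpos]]|noa].
    exact: (refl_pos_inj hPhi bP aP bpos apos).
  by case: (noa (alpha i)); split=> //; apply/(pos_rootP hPhi hDelta).
have NBCE A : NBC Phi Delta s A <-> nbc alpha A by rewrite /NBC inv_rootE.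
have mapE A : nbc_map (rprod r) s A = rprod [seq alpha i | i <- enum A] *m rprod r.
  rewrite /nbc_map /rprod -map_comp; congr (mxprod _ *m _).
  by apply: eq_map => i; rewrite (inv_refl_roots i sE).
have hfun : set_fun (NBC Phi Delta s) (lower_interval Phi Delta (rprod r))
    (nbc_map (rprod r) s).
  move=> A _; rewrite mapE; apply/(lower_intervalP hPhi hDelta); split.
    by apply: W_mul (W_rprod (sub_roots hPhi hDelta red (A := A))) (W_w hDelta red).
  by have [L _ Lw] := set_walk hPhi hDelta red A; exists L.
split=> //; split; first split.
- move=> surj u /surj [A /NBCE nA <-]; rewrite mapE.
  exact: (bruhat_dist_free hPhi hDelta red (nbc_free nA)).
- move=> dist_abs u /(lower_intervalP hPhi hDelta) [Wu [L Lw]].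
  have Wx : refl_group Phi (rprod L) by apply: W_rprod; apply: walk_roots Lw.
  have [X [fX XP XE]] := free_reflection_factorization hPhi hDelta Wx.
  have uE : u = rprod X *m rprod r by rewrite -XE; exact: walk_rprod Lw.
  have [|A nA AE] := nbc_exists hPhi hDelta red dist_abs fX XP.
    by exists L; rewrite -uE.
  by exists A; [exact/NBCE|rewrite mapE AE uE].
move=> surj; split=> // A B /set_mem/NBCE nA /set_mem/NBCE nB; rewrite !mapE => AB.
exact: nbc_rprod_inj nA nB (mulmxr_w_inj hDelta red AB).
Qed.
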